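(* Let $q\ge2$. If $K$ is a $q$-periodic almost classical virtual knot diagram with quotient $K_*$, then $K_*$ is also almost classical.
   Context: A virtual knot diagram is an immersed oriented circle in the plane with transverse double points marked classical (with over/under information) or virtual. It is $q$-periodic if it misses the origin and is invariant under rotation of the plane by $2\pi/q$ about the origin. Its quotient $K_*$ is the virtual knot diagram obtained by taking one fundamental domain (a sector of angle $2\pi/q$ centered at the origin) and joining the corresponding endpoints on its two edges by concentric circular arcs. A virtual knot diagram is almost classical if it admits an Alexander numbering, i.e. an integer-valued function on its short arcs (arcs between consecutive classical crossing points) such that at each classical crossing, drawn with both strands oriented downwards, the two left-hand arcs have a common number $\lambda$ and the two right-hand arcs have number $\lambda+1$ (numbers are unchanged through virtual crossings). *)

(* Defs.v *)
From Stdlib Require Import Reals ZArith List.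
From Coquelicot Require Import Coquelicot.

Open Scope R_scope.

(** * Planar geometry *)

Definition plane : Type := (R * R)%type.

Definition polar (r theta : R) : plane := (r * cos theta, r * sin theta).

Definition rotation (theta : R) (p : plane) : plane :=
  (cos theta * fst p - sin theta * snd p, sin theta * fst p + cos theta * snd p).

Definition det2 (u v : plane) : R := fst u * snd v - snd u * fst v.

Definition is_tangent (c : R -> plane) (t : R) (v : plane) : Prop :=
  is_derive (fun x => fst (c x)) t (fst v) /\
  is_derive (fun x => snd (c x)) t (snd v).

Definition C1_curve (g dg : R -> plane) : Prop :=
  forall t, is_tangent g t (dg t) /\
    continuous (fun x => fst (dg x)) t /\ continuous (fun x => snd (dg x)) t.

(** Near [t] the curve is a C1 regular arc up to [t] followed by a C1 regular
    arc from [t] on, without cusp (the one-sided tangents are not opposite).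
    Requiring this at every parameter of a closed curve amounts, by
    compactness, to being a piecewise C1 immersion.  Corners have to be
    allowed: a quotient diagram has one wherever a circular arc is attached. *)
Definition immersed_at (c : R -> plane) (t : R) : Prop :=
  exists (eps : R) (gl dgl gr dgr : R -> plane),
    0 < eps /\ C1_curve gl dgl /\ C1_curve gr dgr /\
    (forall u, t - eps < u <= t -> c u = gl u) /\
    (forall u, t <= u < t + eps -> c u = gr u) /\
    dgl t <> (0, 0) /\ dgr t <> (0, 0) /\
    (forall k, 0 < k -> dgr t <> (- k * fst (dgl t), - k * snd (dgl t))).

(** * Virtual knot diagrams *)

(** The source circle is R/Z; its orientation is that of R. *)
Definition eqmod1 (s t : R) : Prop := exists k : Z, t = s + IZR k.

(** How a strand passes through a double point. *)
Inductive strand : Set := Over | Under | Virtual.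

(** [role D t] is meaningful only when [curve D t] is a double point. *)
Record diagram : Type := Diagram { curve : R -> plane; role : R -> strand }.

Definition crossing (D : diagram) (s t : R) : Prop :=
  curve D s = curve D t /\ ~ eqmod1 s t.

Definition crossing_param (D : diagram) (t : R) : Prop :=
  exists s, crossing D s t.

Definition classical_crossing (D : diagram) (s t : R) : Prop :=
  crossing D s t /\ role D s <> Virtual /\ role D t <> Virtual.

Definition classical_param (D : diagram) (t : R) : Prop :=
  exists s, classical_crossing D s t.

Record virtual_knot_diagram (D : diagram) : Prop := {
  curve_periodic : forall t, curve D (t + 1) = curve D t;
  role_periodic : forall t, role D (t + 1) = role D t;
  curve_immersed : forall t, immersed_at (curve D) t;
  crossings_finite : exists l : list R,
    forall t, crossing_param D t -> exists s, In s l /\ eqmod1 s t;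
  crossings_double : forall s t u,
    crossing D s t -> crossing D s u -> eqmod1 t u;
  crossings_transverse : forall s t, crossing D s t ->
    exists u v, is_tangent (curve D) s u /\ is_tangent (curve D) t v /\
      det2 u v <> 0;
  crossings_marked : forall s t, crossing D s t ->
    (role D s = Over /\ role D t = Under) \/
    (role D s = Under /\ role D t = Over) \/
    (role D s = Virtual /\ role D t = Virtual)
}.

Definition increasing_cont (f : R -> R) : Prop :=
  (forall u v, u < v -> f u < f v) /\ (forall t, continuous f t).

Definition decreasing_cont (f : R -> R) : Prop :=
  (forall u v, u < v -> f v < f u) /\ (forall t, continuous f t).

(** Equality of diagrams as marked oriented curves in the plane, that is, up to
    an orientation preserving homeomorphism of the source circle. *)
Definition same_diagram (D D' : diagram) : Prop :=
  exists h : R -> R,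
    increasing_cont h /\ (forall t, h (t + 1) = h t + 1) /\
    (forall t, curve D' t = curve D (h t)) /\
    (forall t, crossing_param D' t -> role D' t = role D (h t)).

(** * Almost classical diagrams *)

Definition value_before (num : R -> Z) (t : R) (m : Z) : Prop :=
  exists eps, 0 < eps /\ forall u, t - eps < u < t -> num u = m.

Definition value_after (num : R -> Z) (t : R) (m : Z) : Prop :=
  exists eps, 0 < eps /\ forall u, t < u < t + eps -> num u = m.

(** A function on the short arcs is given as a function on the source circle
    constant on every interval free of classical crossings; its values at the
    classical crossings themselves play no role.
    When both strands are drawn downwards, [det2 u v < 0] says that the strand
    at [s] (tangent [u]) runs from top left to bottom right and the strand at
    [t] (tangent [v]) from top right to bottom left.  Hence the left-hand arcs
    are the one before [s] and the one after [t]. *)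
Definition alexander_numbering (D : diagram) (num : R -> Z) : Prop :=
  (forall t, num (t + 1) = num t) /\
  (forall s t, s <= t -> (forall u, s <= u <= t -> ~ classical_param D u) ->
     num s = num t) /\
  (forall s t u v, classical_crossing D s t ->
     is_tangent (curve D) s u -> is_tangent (curve D) t v -> det2 u v < 0 ->
     exists lambda : Z,
       value_before num s lambda /\ value_after num t lambda /\
       value_before num t (lambda + 1) /\ value_after num s (lambda + 1)).

Definition almost_classical (D : diagram) : Prop :=
  exists num : R -> Z, alexander_numbering D num.

(** * Periodic diagrams and their quotients *)

Definition rotate (theta : R) (D : diagram) : diagram :=
  Diagram (fun t => rotation theta (curve D t)) (role D).

Definition periodic (q : nat) (D : diagram) : Prop :=
  (forall t, curve D t <> (0, 0)) /\
  same_diagram D (rotate (2 * PI / INR q) D).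

Definition on_ray (theta : R) (p : plane) : Prop :=
  exists r, 0 < r /\ p = polar r theta.

Definition in_open_sector (theta0 theta1 : R) (p : plane) : Prop :=
  exists r theta, 0 < r /\ theta0 < theta < theta1 /\ p = polar r theta.

Definition transverse_to_ray (D : diagram) (theta : R) : Prop :=
  forall t, on_ray theta (curve D t) ->
    ~ crossing_param D t /\
    exists v, is_tangent (curve D) t v /\ det2 (polar 1 theta) v <> 0.

(** [curve D] restricted to [[a, b]] is one of the arcs cut out by the closed
    sector, whose edges [curve D] is assumed to meet transversely. *)
Definition sector_arc (D : diagram) (theta0 theta1 a b : R) : Prop :=
  a < b /\
  (on_ray theta0 (curve D a) \/ on_ray theta1 (curve D a)) /\
  (on_ray theta0 (curve D b) \/ on_ray theta1 (curve D b)) /\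
  (forall t, a < t < b -> in_open_sector theta0 theta1 (curve D t)).

(** Between the parameters [a] and [b], the curve runs along a circular arc
    centered at the origin, outside the sector, from one edge to the other:
    counterclockwise from [theta1] or clockwise from [theta0]. *)
Definition concentric_arc (D : diagram) (theta0 theta1 a b : R) : Prop :=
  exists (r : R) (alpha : R -> R),
    0 < r /\
    (forall t, a <= t <= b -> curve D t = polar r (alpha t)) /\
    ((increasing_cont alpha /\ alpha a = theta1 /\ alpha b = theta0 + 2 * PI) \/
     (decreasing_cont alpha /\ alpha a = theta0 /\ alpha b = theta1 - 2 * PI)).

(** [Ks] is obtained from the sector [theta0 <= theta <= theta0 + 2 * PI / q].
    Its circle is cut as [c 0 < d 0 < c 1 < ... < c n = c 0 + 1]: on
    [[c i, d i]] it follows (through [phi i], with orientation and marking) an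
    arc of [K] in the sector, each such arc being used exactly once, and on
    [[d i, c (i + 1)]] a concentric arc.  As usual the edges of the sector
    avoid the crossings and are transverse to [K]. *)
Definition is_quotient (q : nat) (K Ks : diagram) : Prop :=
  virtual_knot_diagram Ks /\
  exists (theta0 theta1 : R) (n : nat) (c d : nat -> R) (phi : nat -> R -> R),
    theta1 = theta0 + 2 * PI / INR q /\
    transverse_to_ray K theta0 /\ transverse_to_ray K theta1 /\
    c n = c O + 1 /\
    (forall i, (i < n)%nat ->
       c i < d i < c (S i) /\
       increasing_cont (phi i) /\
       sector_arc K theta0 theta1 (phi i (c i)) (phi i (d i)) /\
       (forall t, c i <= t <= d i ->
          curve Ks t = curve K (phi i t) /\
          (crossing_param K (phi i t) -> role Ks t = role K (phi i t))) /\
       concentric_arc Ks theta0 theta1 (d i) (c (S i))) /\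
    (forall a b, sector_arc K theta0 theta1 a b ->
       exists! i, (i < n)%nat /\
         exists k : Z, a = phi i (c i) + IZR k /\ b = phi i (d i) + IZR k).

(* Main.v *)
(** A numbering of [K] precomposed with the lift [h] of the rotation is again a
    numbering, with the same jumps at the classical crossings; so the two
    differ by a constant, which vanishes because [h] has finite order on the
    circle.  The numbering of [K] is thus rotation invariant and descends to
    the arcs of [K] in the sector.  It agrees at the two ends of a concentric
    arc, since these correspond to points of [K] exchanged by the rotation, and
    concentric arcs carry no crossings, so it extends constantly along them.
    Conversely, every crossing of [K] inside the sector is a crossing of the
    quotient, because each strand of [K] in the sector belongs to exactly one
    of the arcs used. *)

Require Import Defs.
From Stdlib Require Import Reals ZArith List.
From Coquelicot Require Import Coquelicot.
From Stdlib Require Import Lra Lia Classical IndefiniteDescription.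

Open Scope R_scope.

(** * Intervals and continuous functions *)

(** The maps [h] and [phi i] are merely increasing and continuous, so no chain rule transports
    tangents. What survives is that a tangent of the reparametrized curve is a nonnegative multiple
    of the original one; with transversality this still fixes the sign of [det2] at a crossing. That
    sign determines the jump of a numbering along a strand, which is why [num] and [num] composed
    with [h] jump alike and their difference has equal values on both sides of each classical
    parameter. The bound [2 <= q] makes the angle of the sector at most π. The sector is then cut
    out by two half planes, a single continuous function detects it, and the arcs of [K] are found
    between zeros of that function. Crossings are compared in both directions: those of the quotient
    must come from [K] for the jump condition, and those of [K] in the sector must survive, because
    constancy is tested on intervals free of classical crossings of the quotient. That concentric
    arcs avoid all crossings is not built into [is_quotient]; it follows from finiteness of the
    crossings, as every such arc sweeps the same range of angles. *)

Lemma interval_induction (P : R -> Prop) (a b : R) :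
  P a ->
  (forall x, a <= x -> (forall y, a <= y <= x -> P y) ->
     exists eps, 0 < eps /\ forall y, x <= y < x + eps -> P y) ->
  (forall x, a < x <= b -> (forall y, a <= y < x -> P y) -> P x) ->
  forall x, a <= x <= b -> P x.
Proof.
intros Pa Hstep Hlim x0 Hx0.
(* [E] collects the good initial segments. The limit hypothesis puts its supremum [m] in [E], and
   the step hypothesis would go beyond [m] if [m < b]. *)
set (E := fun x => a <= x <= b /\ forall y, a <= y <= x -> P y).
assert (Ea : E a).
{ split; [lra|]. intros y Hy. replace y with a by lra. exact Pa. }
destruct (completeness E) as [m [Hub Hleast]].
{ exists b. intros x [Hx _]. lra. }
{ exists a. exact Ea. }
assert (Ham : a <= m) by (apply Hub; exact Ea).
assert (Hmb : m <= b) by (apply Hleast; intros x [Hx _]; lra).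
assert (Hbelow : forall y, a <= y < m -> P y).
{ intros y Hy. apply NNPP. intro HnP.
  assert (m <= y); [|lra].
  apply Hleast. intros x [Hx HE].
  destruct (Rle_lt_dec x y) as [|Hlt]; [assumption|].
  exfalso. apply HnP, HE. lra. }
assert (Pm : P m).
{ destruct (Rle_lt_or_eq_dec a m Ham) as [Hlt|Heq].
  - apply Hlim; [lra|exact Hbelow].
  - rewrite <- Heq. exact Pa. }
assert (Hupto : forall y, a <= y <= m -> P y).
{ intros y Hy. destruct (Rle_lt_or_eq_dec y m) as [Hlt|Heq]; [lra| |].
  - apply Hbelow. lra.
  - rewrite Heq. exact Pm. }
destruct (Rle_lt_or_eq_dec m b Hmb) as [Hlt|Heq].
2: { apply Hupto. lra. }
destruct (Hstep m Ham Hupto) as [eps [Heps Hnext]].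
set (z := Rmin b (m + eps / 2)).
assert (Hz : m < z /\ z <= b /\ z < m + eps).
{ unfold z, Rmin. destruct (Rle_dec b (m + eps / 2)); lra. }
assert (z <= m); [|lra].
apply Hub. split; [lra|].
intros y Hy. destruct (Rle_lt_dec y m).
- apply Hupto. lra.
- apply Hnext. lra.
Qed.

(** The two sides of [x] are controlled separately because at a cut point of the quotient they lie
    in different pieces. *)
Lemma locally_constant_interval (f : R -> Z) (s t : R) :
  s <= t ->
  (forall x, s <= x <= t -> exists eps, 0 < eps /\
     (forall y, x - eps < y <= x -> f y = f x) /\
     (forall y, x <= y < x + eps -> f y = f x)) ->
  f s = f t.
Proof.
intros Hst Hloc. symmetry.
(* The guard [x <= t] makes the step condition vacuous to the right of [t], where [f] is not
   controlled. *)
apply (interval_induction (fun x => x <= t -> f x = f s) s t);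
  [reflexivity| | |lra|lra].
- intros x Hx Hall.
  destruct (Rle_lt_dec x t) as [Hxt|Hxt].
  + destruct (Hloc x) as [eps [Heps [_ Hr]]]; [lra|].
    exists eps. split; [exact Heps|]. intros y Hy _.
    rewrite Hr by lra. apply Hall; lra.
  + exists 1. split; [lra|]. intros; lra.
- intros x Hx Hall _.
  destruct (Hloc x) as [eps [Heps [Hl _]]]; [lra|].
  assert (Hm : x - eps < Rmax s (x - eps / 2) < x /\ s <= Rmax s (x - eps / 2)).
  { unfold Rmax. destruct (Rle_dec s (x - eps / 2)); lra. }
  rewrite <- (Hl (Rmax s (x - eps / 2))) by lra.
  apply Hall; lra.
Qed.

(** Centres are left out because the value of a numbering at a classical parameter is not tied to
    the neighbouring ones. Overlapping punctured neighbourhoods share their constant, which real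
    induction carries to the right. *)
Lemma punctured_locally_constant (f : R -> Z) :
  (forall t, exists m eps, 0 < eps /\ forall u, 0 < Rabs (u - t) < eps -> f u = m) ->
  exists m, forall t, exists eps, 0 < eps /\
    forall u, 0 < Rabs (u - t) < eps -> f u = m.
Proof.
intros Hloc.
assert (Hforward : forall a b m, a <= b ->
  (exists eps, 0 < eps /\ forall u, 0 < Rabs (u - a) < eps -> f u = m) ->
  exists eps, 0 < eps /\ forall u, 0 < Rabs (u - b) < eps -> f u = m).
{ intros a b m Hab Ha.
  apply (interval_induction (fun x => exists eps, 0 < eps /\
    forall u, 0 < Rabs (u - x) < eps -> f u = m) a b); [exact Ha| | |lra].
  - intros x Hx Hall. destruct (Hall x) as [eps [Heps He]]; [lra|].
    exists eps. split; [exact Heps|]. intros y Hy.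
    destruct (Rle_lt_or_eq_dec x y) as [Hlt|Heq]; [lra| |].
    (* The bound [y - x] keeps the neighbourhood of [y] away from [x] itself. *)
    + exists (Rmin (y - x) (x + eps - y)).
      split; [apply Rmin_glb_lt; lra|].
      intros u Hu.
      pose proof (Rmin_l (y - x) (x + eps - y)).
      pose proof (Rmin_r (y - x) (x + eps - y)).
      destruct Hu as [_ Hu]. apply Rabs_def2 in Hu.
      apply He. rewrite Rabs_pos_eq; lra.
    + exists eps. subst y. split; assumption.
  - intros x Hx Hall. destruct (Hloc x) as [m' [eps [Heps He]]].
    set (y := Rmax a (x - eps / 2)).
    assert (Hy : a <= y < x /\ x - eps < y).
    { unfold y, Rmax. destruct (Rle_dec a (x - eps / 2)); lra. }
    destruct (Hall y) as [e' [He'0 He']]; [lra|].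
    set (u := y + Rmin (e' / 2) ((x - y) / 2)).
    assert (Hu : y < u /\ u < y + e' /\ u < x).
    { unfold u, Rmin. destruct (Rle_dec (e' / 2) ((x - y) / 2)); lra. }
    assert (m = m').
    { rewrite <- (He' u), <- (He u); [reflexivity| |].
      - rewrite Rabs_left; lra.
      - rewrite Rabs_right; lra. }
    subst m'. exists eps. split; assumption. }
destruct (Hloc 0) as [m Hm]. exists m. intros t.
destruct (Rle_lt_dec 0 t) as [Ht|Ht].
- apply (Hforward 0 t m Ht Hm).
(* To the left of 0, the constant of [t] is propagated forward to 0 and compared there with [m]. *)
- destruct (Hloc t) as [m' Ht'].
  assert (H0 : exists eps, 0 < eps /\
    forall u, 0 < Rabs (u - 0) < eps -> f u = m').
  { apply (Hforward t 0 m'); [lra|exact Ht']. }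
  destruct Hm as [e1 [He1 H1]]. destruct H0 as [e2 [He2 H2]].
  assert (m = m').
  { assert (Hmin : 0 < Rmin e1 e2) by (apply Rmin_glb_lt; lra).
    pose proof (Rmin_l e1 e2). pose proof (Rmin_r e1 e2).
    rewrite <- (H1 (Rmin e1 e2 / 2)), <- (H2 (Rmin e1 e2 / 2));
      [reflexivity| |]; rewrite Rabs_right; lra. }
  subst m'. exact Ht'.
Qed.

Lemma continuous_eps (f : R -> R) (x eps : R) :
  continuous f x -> 0 < eps ->
  exists delta, 0 < delta /\
    forall u, Rabs (u - x) < delta -> Rabs (f u - f x) < eps.
Proof.
intros Hf Heps.
apply continuity_pt_filterlim in Hf.
apply continuity_pt_locally with (eps := mkposreal eps Heps) in Hf.
destruct Hf as [d Hd]. exists d. split; [apply cond_pos|].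
intros u Hu. apply Hd. exact Hu.
Qed.

Lemma increasing_cont_shift (f : R -> R) (k : R) :
  increasing_cont f -> increasing_cont (fun x => f (x + k)).
Proof.
intros [Hi Hc]. split.
- intros u v Huv. apply Hi. lra.
- intros t. apply (continuous_comp (fun x => x + k) f).
  + apply (continuous_plus (fun x => x) (fun _ => k));
      [apply continuous_id|apply continuous_const].
  + apply Hc.
Qed.

Lemma increasing_cont_inj (f : R -> R) (x y : R) :
  increasing_cont f -> f x = f y -> x = y.
Proof.
intros [Hi _] H. destruct (Rtotal_order x y) as [Hlt|[Heq|Hgt]];
  [apply Hi in Hlt; lra|exact Heq|apply Hi in Hgt; lra].
Qed.

Lemma increasing_cont_lt_inv (f : R -> R) (x y : R) :
  increasing_cont f -> f x < f y -> x < y.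
Proof.
intros [Hi _] H. destruct (Rtotal_order x y) as [Hlt|[Heq|Hgt]];
  [exact Hlt|subst; lra|apply Hi in Hgt; lra].
Qed.

Lemma continuous_surj (f : R -> R) (a b y : R) :
  (forall t, continuous f t) -> a <= b ->
  f a <= y <= f b \/ f b <= y <= f a ->
  exists x, a <= x <= b /\ f x = y.
Proof.
intros Hc Hab Hy.
destruct (IVT_gen f a b y) as [x [Hx Hfx]].
- intro t. apply continuity_pt_filterlim. apply Hc.
- unfold Rmin, Rmax. destruct (Rle_dec (f a) (f b)); lra.
- exists x. rewrite Rmin_left, Rmax_right in Hx by lra. split; assumption.
Qed.

(** If there were no such zero, positivity would spread up to [b] by real induction: it is an open
    condition, and at a limit point a negative value contradicts continuity while a zero would be
    the first one. *)
Lemma first_zero_right (f : R -> R) (a b : R) :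
  (forall t, continuous f t) -> a <= b -> 0 < f a -> f b <= 0 ->
  exists z, a < z <= b /\ f z = 0 /\ forall x, a <= x < z -> 0 < f x.
Proof.
intros Hc Hab Ha Hb.
apply NNPP. intro Hno.
assert (0 < f b); [|lra].
apply (interval_induction (fun x => 0 < f x) a b); [exact Ha| | |lra].
- intros x Hax Hall. assert (Hx : 0 < f x) by (apply Hall; lra).
  destruct (continuous_eps f x (f x) (Hc x) Hx) as [d [Hd Hcd]].
  exists d. split; [exact Hd|]. intros y Hy.
  assert (Habs : Rabs (f y - f x) < f x) by (apply Hcd; rewrite Rabs_pos_eq; lra).
  apply Rabs_def2 in Habs. lra.
- intros x Hx Hall.
  destruct (Rtotal_order (f x) 0) as [Hlt|[Heq|Hgt]]; [| |exact Hgt].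
  + destruct (continuous_eps f x (- f x) (Hc x)) as [d [Hd Hcd]]; [lra|].
    set (y := Rmax a (x - d / 2)).
    assert (Hy : a <= y < x /\ x - d < y).
    { unfold y, Rmax. destruct (Rle_dec a (x - d / 2)); lra. }
    assert (Habs : Rabs (f y - f x) < - f x).
    { apply Hcd. rewrite Rabs_left; lra. }
    apply Rabs_def2 in Habs. specialize (Hall y ltac:(lra)). lra.
  + exfalso. apply Hno. exists x. repeat split; try lra. exact Hall.
Qed.

Lemma first_zero_left (f : R -> R) (a b : R) :
  (forall t, continuous f t) -> b <= a -> 0 < f a -> f b <= 0 ->
  exists z, b <= z < a /\ f z = 0 /\ forall x, z < x <= a -> 0 < f x.
Proof.
intros Hc Hab Ha Hb.
destruct (first_zero_right (fun x => f (- x)) (- a) (- b)) as [z [Hz [Hfz Hpos]]].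
- intro t. apply (continuous_comp Ropp f).
  + apply (continuous_opp (V := R_NormedModule) (fun x : R => x)).
    apply continuous_id.
  + apply Hc.
- lra.
- rewrite Ropp_involutive. exact Ha.
- rewrite Ropp_involutive. exact Hb.
- exists (- z). repeat split; try lra.
  intros x Hx. rewrite <- (Ropp_involutive x). apply Hpos. lra.
Qed.

(** * The circle R/Z and crossing parameters *)

Lemma periodic_shift {A : Type} (f : R -> A) :
  (forall t, f (t + 1) = f t) -> forall (k : Z) (t : R), f (t + IZR k) = f t.
Proof.
intros Hf k. apply (Z.peano_ind (fun k => forall t, f (t + IZR k) = f t)).
- intro t. f_equal. lra.
- intros x IH t. rewrite succ_IZR, <- Rplus_assoc, Hf. apply IH.
- intros x IH t. rewrite <- Hf, <- (IH t). f_equal.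
  rewrite <- Z.sub_1_r, minus_IZR. lra.
Qed.

Lemma IZR_lt1_eq0 (k : Z) : -1 < IZR k < 1 -> k = 0%Z.
Proof.
intros [H1 H2]. apply (lt_IZR (-1)) in H1. apply (lt_IZR _ 1) in H2. lia.
Qed.

Lemma eqmod1_refl (s : R) : eqmod1 s s.
Proof. exists 0%Z. lra. Qed.

Lemma eqmod1_sym (s t : R) : eqmod1 s t -> eqmod1 t s.
Proof. intros [k Hk]. exists (- k)%Z. rewrite opp_IZR. lra. Qed.

Lemma eqmod1_trans (s t u : R) : eqmod1 s t -> eqmod1 t u -> eqmod1 s u.
Proof. intros [k Hk] [j Hj]. exists (k + j)%Z. rewrite plus_IZR. lra. Qed.

Lemma eqmod1_shift (s : R) (k : Z) : eqmod1 s (s + IZR k).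
Proof. exists k. reflexivity. Qed.

Lemma eqmod1_close (s t : R) : eqmod1 s t -> Rabs (t - s) < 1 -> s = t.
Proof.
intros [k Hk] H. apply Rabs_def2 in H.
rewrite (IZR_lt1_eq0 k) in Hk; lra.
Qed.

Lemma fundamental_domain (a t : R) : exists k : Z, a <= t + IZR k < a + 1.
Proof.
exists (- up (t - a) + 1)%Z. destruct (archimed (t - a)) as [H1 H2].
rewrite plus_IZR, opp_IZR. lra.
Qed.

Lemma eqmod1_isolated (s t : R) :
  exists eps, 0 < eps /\ forall u, 0 < Rabs (u - t) < eps -> ~ eqmod1 s u.
Proof.
destruct (fundamental_domain s t) as [k Hk].
destruct (Rle_lt_or_eq_dec s (t + IZR k)) as [Hlt|Heq]; [lra| |].
- exists (Rmin (t + IZR k - s) (s + 1 - (t + IZR k))).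
  split; [apply Rmin_glb_lt; lra|].
  intros u [_ Hu] Heqm.
  pose proof (Rmin_l (t + IZR k - s) (s + 1 - (t + IZR k))).
  pose proof (Rmin_r (t + IZR k - s) (s + 1 - (t + IZR k))).
  apply Rabs_def2 in Hu.
  assert (s = u + IZR k); [|lra].
  apply eqmod1_close.
  + apply (eqmod1_trans _ u); [exact Heqm|apply eqmod1_shift].
  + apply Rabs_def1; lra.
- exists 1. split; [lra|]. intros u [Hu0 Hu] Heqm.
  assert (t = u).
  { apply eqmod1_close; [|exact Hu].
    apply (eqmod1_trans _ s); [|exact Heqm].
    apply eqmod1_sym. subst s.
    apply eqmod1_sym, eqmod1_shift. }
  subst u. rewrite Rminus_diag, Rabs_R0 in Hu0. lra.
Qed.

Section Circle.

Variables (D : diagram).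
Hypothesis hD : virtual_knot_diagram D.

Lemma curve_eqmod1 (s t : R) : eqmod1 s t -> curve D t = curve D s.
Proof. intros [k ->]. apply periodic_shift, (curve_periodic _ hD). Qed.

Lemma role_eqmod1 (s t : R) : eqmod1 s t -> role D t = role D s.
Proof. intros [k ->]. apply periodic_shift, (role_periodic _ hD). Qed.

Lemma crossing_eqmod1 (s t s' t' : R) :
  eqmod1 s s' -> eqmod1 t t' -> crossing D s t -> crossing D s' t'.
Proof.
intros Hs Ht [Hc Hn]. split.
- rewrite (curve_eqmod1 s s' Hs), (curve_eqmod1 t t' Ht). exact Hc.
- intro H. apply Hn. apply (eqmod1_trans _ s'); [exact Hs|].
  apply (eqmod1_trans _ t'); [exact H|]. apply eqmod1_sym, Ht.
Qed.

Lemma classical_crossing_eqmod1 (s t s' t' : R) :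
  eqmod1 s s' -> eqmod1 t t' ->
  classical_crossing D s t -> classical_crossing D s' t'.
Proof.
intros Hs Ht (Hc & H1 & H2). split; [|split].
- apply (crossing_eqmod1 s t); assumption.
- rewrite (role_eqmod1 s s' Hs). exact H1.
- rewrite (role_eqmod1 t t' Ht). exact H2.
Qed.

Lemma crossing_sym (s t : R) : crossing D s t -> crossing D t s.
Proof.
intros [Hc Hn]. split; [symmetry; exact Hc|].
intro H. apply Hn, eqmod1_sym, H.
Qed.

Lemma classical_crossing_sym (s t : R) :
  classical_crossing D s t -> classical_crossing D t s.
Proof. intros (Hc & H1 & H2). split; [apply crossing_sym, Hc|tauto]. Qed.

Lemma classical_param_crossing (t : R) :
  classical_param D t -> crossing_param D t.
Proof. intros [s [Hc _]]. exists s. exact Hc. Qed.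

Lemma crossings_isolated (t : R) :
  exists eps, 0 < eps /\
    forall u, 0 < Rabs (u - t) < eps -> ~ crossing_param D u.
Proof.
destruct (crossings_finite _ hD) as [l Hl].
assert (H : exists eps, 0 < eps /\ forall s u, In s l ->
  0 < Rabs (u - t) < eps -> ~ eqmod1 s u).
{ clear Hl. induction l as [|s l [e [He IH]]].
  - exists 1. split; [lra|]. intros s u [].
  - destruct (eqmod1_isolated s t) as [e' [He' Hs]].
    exists (Rmin e e'). split; [apply Rmin_glb_lt; assumption|].
    pose proof (Rmin_l e e'). pose proof (Rmin_r e e').
    intros s' u [->|Hin] Hu; [apply Hs; lra|apply (IH s' u Hin); lra]. }
destruct H as [e [He H]]. exists e. split; [exact He|].
intros u Hu Hc. destruct (Hl u Hc) as [s [Hin Hs]].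
exact (H s u Hin Hu Hs).
Qed.

Lemma noncrossing_curve_inj (s t : R) :
  ~ crossing_param D t -> curve D s = curve D t -> eqmod1 s t.
Proof.
intros Hn Hc. apply NNPP. intro H. apply Hn. exists s. split; assumption.
Qed.

Lemma curve_continuous (t : R) :
  continuous (fun x => fst (curve D x)) t /\
  continuous (fun x => snd (curve D x)) t.
Proof.
destruct (curve_immersed _ hD t)
  as (eps & gl & dgl & gr & dgr & Heps & Hgl & Hgr & Hl & Hr & _).
assert (Hpr : forall pr : plane -> R,
  continuous (fun x => pr (gl x)) t -> continuous (fun x => pr (gr x)) t ->
  continuous (fun x => pr (curve D x)) t).
{ intros pr Hcl Hcr. apply continuity_pt_filterlim, continuity_pt_locally.
  intros [e He].
  destruct (continuous_eps _ t e Hcl He) as [d1 [Hd1 H1]].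
  destruct (continuous_eps _ t e Hcr He) as [d2 [Hd2 H2]].
  assert (Hd : 0 < Rmin eps (Rmin d1 d2)) by (repeat apply Rmin_glb_lt; lra).
  exists (mkposreal _ Hd). intros u Hu. simpl in *.
  change (Rabs (u - t) < Rmin eps (Rmin d1 d2)) in Hu.
  pose proof (Rmin_l eps (Rmin d1 d2)). pose proof (Rmin_r eps (Rmin d1 d2)).
  pose proof (Rmin_l d1 d2). pose proof (Rmin_r d1 d2).
  assert (Habs : Rabs (u - t) < eps) by lra. apply Rabs_def2 in Habs.
  destruct (Rle_lt_dec u t).
  - rewrite (Hl u), (Hl t) by lra. apply H1. lra.
  - rewrite (Hr u), (Hr t) by lra. apply H2. lra. }
destruct (Hgl t) as [[T1 T2] _]. destruct (Hgr t) as [[T3 T4] _].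
split; [apply (Hpr fst)|apply (Hpr snd)];
  apply (ex_derive_continuous (V := R_NormedModule)); eexists; eassumption.
Qed.

Lemma numbering_locally_constant (num : R -> Z) (t : R) :
  alexander_numbering D num -> ~ classical_param D t ->
  exists eps, 0 < eps /\ forall u, Rabs (u - t) < eps -> num u = num t.
Proof.
intros (_ & Hconst & _) Ht.
destruct (crossings_isolated t) as [eps [Heps He]].
exists eps. split; [exact Heps|]. intros u Hu.
assert (Hfree : forall x, Rabs (x - t) < eps -> ~ classical_param D x).
{ intros x Hx. destruct (Req_dec x t) as [->|Hne]; [exact Ht|].
  intro Hc. apply (He x); [|apply classical_param_crossing, Hc].
  split; [apply Rabs_pos_lt; lra|exact Hx]. }
apply Rabs_def2 in Hu.
destruct (Rle_lt_dec u t).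
- apply Hconst; [lra|]. intros x Hx. apply Hfree, Rabs_def1; lra.
- symmetry. apply Hconst; [lra|]. intros x Hx. apply Hfree, Rabs_def1; lra.
Qed.

End Circle.

(** * One-sided values under reparametrization and local change *)

Lemma value_before_comp (num : R -> Z) (phi : R -> R) (t : R) (m : Z) :
  increasing_cont phi -> value_before num (phi t) m ->
  value_before (fun u => num (phi u)) t m.
Proof.
intros [Hi Hc] [eps [Heps H]].
destruct (continuous_eps phi t eps (Hc t) Heps) as [d [Hd Hphi]].
exists d. split; [exact Hd|]. intros u Hu. apply H.
assert (Habs : Rabs (phi u - phi t) < eps).
{ apply Hphi. rewrite Rabs_left; lra. }
apply Rabs_def2 in Habs. specialize (Hi u t). lra.
Qed.

Lemma value_after_comp (num : R -> Z) (phi : R -> R) (t : R) (m : Z) :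
  increasing_cont phi -> value_after num (phi t) m ->
  value_after (fun u => num (phi u)) t m.
Proof.
intros [Hi Hc] [eps [Heps H]].
destruct (continuous_eps phi t eps (Hc t) Heps) as [d [Hd Hphi]].
exists d. split; [exact Hd|]. intros u Hu. apply H.
assert (Habs : Rabs (phi u - phi t) < eps).
{ apply Hphi. rewrite Rabs_pos_eq; lra. }
apply Rabs_def2 in Habs. specialize (Hi t u). lra.
Qed.

Lemma value_before_ext (num num' : R -> Z) (t : R) (m : Z) :
  (exists eps, 0 < eps /\ forall u, Rabs (u - t) < eps -> num' u = num u) ->
  value_before num t m -> value_before num' t m.
Proof.
intros [e [He Heq]] [e' [He' H]]. exists (Rmin e e').
split; [apply Rmin_glb_lt; assumption|]. intros u Hu.
pose proof (Rmin_l e e'). pose proof (Rmin_r e e').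
rewrite Heq; [apply H; lra|]. rewrite Rabs_left; lra.
Qed.

Lemma value_after_ext (num num' : R -> Z) (t : R) (m : Z) :
  (exists eps, 0 < eps /\ forall u, Rabs (u - t) < eps -> num' u = num u) ->
  value_after num t m -> value_after num' t m.
Proof.
intros [e [He Heq]] [e' [He' H]]. exists (Rmin e e').
split; [apply Rmin_glb_lt; assumption|]. intros u Hu.
pose proof (Rmin_l e e'). pose proof (Rmin_r e e').
rewrite Heq; [apply H; lra|]. rewrite Rabs_pos_eq; lra.
Qed.

(** * Tangents, rotations and sectors *)

Lemma strictly_increasing_at (p : R -> R) (x l : R) :
  is_derive p x l -> 0 < l ->
  exists eps, 0 < eps /\ forall k, 0 < k < eps -> p x < p (x + k).
Proof.
intros Hp Hl. apply is_derive_Reals in Hp.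
destruct (Hp l Hl) as [d Hd]. exists d. split; [apply cond_pos|].
intros k Hk. specialize (Hd k ltac:(lra)).
rewrite Rabs_pos_eq in Hd by lra. specialize (Hd ltac:(lra)).
apply Rabs_def2 in Hd.
assert (Hq : 0 < (p (x + k) - p x) / k) by lra.
apply Rmult_lt_compat_r with (r := k) in Hq; [|lra].
unfold Rdiv in Hq. rewrite Rmult_assoc, Rinv_l in Hq; lra.
Qed.

(** Just after [s], [phi] has moved to the right of [phi s], where [p] exceeds its value there, so
    [P] cannot be decreasing. The inequality is only weak because [phi] may have speed zero at
    [s]. *)
Lemma reparametrized_derive_ge0 (p P phi : R -> R) (s l l' : R) :
  increasing_cont phi ->
  (exists eps, 0 < eps /\ forall x, Rabs (x - s) < eps -> P x = p (phi x)) ->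
  is_derive P s l -> is_derive p (phi s) l' -> 0 < l' -> 0 <= l.
Proof.
intros [Hi Hc] [e [He HPp]] HP Hp Hl'.
destruct (Rle_lt_dec 0 l) as [|Hneg]; [assumption|exfalso].
destruct (strictly_increasing_at p (phi s) l' Hp Hl') as [e1 [He1 H1]].
destruct (strictly_increasing_at (fun x => - P x) s (- l)) as [e2 [He2 H2]].
{ apply (is_derive_opp (V := R_NormedModule) P s l HP). }
{ lra. }
destruct (continuous_eps phi s e1 (Hc s) He1) as [d [Hd Hphi]].
set (m := Rmin d (Rmin e e2)).
assert (Hm : 0 < m) by (unfold m; repeat apply Rmin_glb_lt; assumption).
pose proof (Rmin_l d (Rmin e e2)). pose proof (Rmin_r d (Rmin e e2)).
pose proof (Rmin_l e e2). pose proof (Rmin_r e e2). fold m in H, H0.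
assert (Habs : forall eps, m <= eps -> Rabs (s + m / 2 - s) < eps).
{ intros eps Heps. rewrite Rabs_pos_eq; lra. }
specialize (H2 (m / 2) ltac:(lra)). simpl in H2.
rewrite (HPp (s + m / 2)), (HPp s) in H2.
2: { rewrite Rminus_diag, Rabs_R0. exact He. }
2: { apply Habs. lra. }
specialize (Hphi (s + m / 2) ltac:(apply Habs; lra)).
apply Rabs_def2 in Hphi. specialize (Hi s (s + m / 2) ltac:(lra)).
specialize (H1 (phi (s + m / 2) - phi s) ltac:(lra)).
replace (phi s + (phi (s + m / 2) - phi s)) with (phi (s + m / 2)) in H1 by lra.
lra.
Qed.

Lemma is_tangent_linear (c : R -> plane) (t : R) (v : plane) (a b : R) :
  is_tangent c t v ->
  is_derive (fun x => a * fst (c x) + b * snd (c x)) t (a * fst v + b * snd v).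
Proof.
intros [H1 H2].
apply (is_derive_plus (V := R_NormedModule)
  (fun x => a * fst (c x)) (fun x => b * snd (c x)));
  apply is_derive_scal; assumption.
Qed.

(** The reparametrization is merely continuous. A linear form positive on the
    tangent [u'] is nonnegative on [u], and the forms close to the one
    vanishing on [u'] force [u] to be a multiple of [u']. *)
Lemma reparametrized_tangent (g c : R -> plane) (phi : R -> R) (s : R)
  (u u' : plane) :
  increasing_cont phi ->
  (exists eps, 0 < eps /\ forall x, Rabs (x - s) < eps -> c x = g (phi x)) ->
  is_tangent c s u -> is_tangent g (phi s) u' -> u' <> (0, 0) ->
  exists lambda, 0 <= lambda /\ u = (lambda * fst u', lambda * snd u').
Proof.
intros Hphi [e [He Hcg]] Hu Hu' Hnz.
assert (Hform : forall a b, 0 < a * fst u' + b * snd u' ->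
  0 <= a * fst u + b * snd u).
{ intros a b Hab.
  apply (reparametrized_derive_ge0 (fun x => a * fst (g x) + b * snd (g x))
    (fun x => a * fst (c x) + b * snd (c x)) phi s _ (a * fst u' + b * snd u') Hphi);
    [| | |exact Hab].
  - exists e. split; [exact He|]. intros x Hx. rewrite Hcg; [reflexivity|exact Hx].
  - apply is_tangent_linear, Hu.
  - apply is_tangent_linear, Hu'. }
destruct u as [u1 u2], u' as [a b]. simpl in *.
assert (Hn : 0 < a * a + b * b).
{ destruct (Req_dec a 0) as [->|Ha]; [|nra].
  destruct (Req_dec b 0) as [->|Hb]; [|nra]. elim Hnz. reflexivity. }
assert (Hdot : 0 <= a * u1 + b * u2) by (apply Hform; nra).
assert (Hlim : forall x, (forall eps, 0 < eps -> 0 <= eps * (a * u1 + b * u2) + x) ->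
  0 <= x).
{ intros x Hx. destruct (Rle_lt_dec 0 x) as [|Hneg]; [assumption|exfalso].
  set (k := a * u1 + b * u2) in *.
  (* As [k] is nonnegative, this choice makes [eps * k] at most [- x / 2], too small to compensate
     [x]. *)
  specialize (Hx (- x / (2 * (k + 1)))).
  assert (Hk : - x / (2 * (k + 1)) * (2 * (k + 1)) = - x) by (field; lra).
  assert (Hpos : 0 < - x / (2 * (k + 1))) by (apply Rdiv_lt_0_compat; lra).
  specialize (Hx Hpos). nra. }
assert (H1 : 0 <= - b * u1 + a * u2).
{ apply Hlim. intros eps Heps.
  replace (eps * (a * u1 + b * u2) + (- b * u1 + a * u2))
    with ((eps * a - b) * u1 + (eps * b + a) * u2) by ring.
  apply Hform. nra. }
assert (H2 : 0 <= b * u1 - a * u2).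
{ apply Hlim. intros eps Heps.
  replace (eps * (a * u1 + b * u2) + (b * u1 - a * u2))
    with ((eps * a + b) * u1 + (eps * b - a) * u2) by ring.
  apply Hform. nra. }
assert (Hdet : b * u1 = a * u2) by lra.
(* The coefficient of the orthogonal projection of [u] onto [u']. *)
exists ((a * u1 + b * u2) / (a * a + b * b)). split.
- apply Rdiv_le_0_compat; lra.
- set (q := (a * u1 + b * u2) / (a * a + b * b)).
  assert (Hq : q * (a * a + b * b) = a * u1 + b * u2) by (unfold q; field; lra).
  assert (Ha : a * (b * u1) = a * (a * u2)) by (rewrite Hdet; ring).
  assert (Hb : b * (b * u1) = b * (a * u2)) by (rewrite Hdet; ring).
  f_equal; apply (Rmult_eq_reg_r (a * a + b * b)); try lra.
  + replace (q * a * (a * a + b * b)) with (q * (a * a + b * b) * a) by ring.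
    rewrite Hq. lra.
  + replace (q * b * (a * a + b * b)) with (q * (a * a + b * b) * b) by ring.
    rewrite Hq. lra.
Qed.

Lemma det2_sym (u v : plane) : det2 v u = - det2 u v.
Proof. unfold det2. ring. Qed.

(** The two determinants differ by a product of nonnegative factors. Transversality downstairs makes
    [u'] and [v'] nonzero, so that these factors exist, and excludes a zero determinant. *)
Lemma reparametrized_det2_lt0 (g c : R -> plane) (phi psi : R -> R) (s t : R)
  (u v u' v' : plane) :
  increasing_cont phi -> increasing_cont psi ->
  (exists eps, 0 < eps /\ forall x, Rabs (x - s) < eps -> c x = g (phi x)) ->
  (exists eps, 0 < eps /\ forall x, Rabs (x - t) < eps -> c x = g (psi x)) ->
  is_tangent c s u -> is_tangent c t v ->
  is_tangent g (phi s) u' -> is_tangent g (psi t) v' ->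
  det2 u v < 0 -> det2 u' v' <> 0 -> det2 u' v' < 0.
Proof.
intros Hphi Hpsi Hs Ht Hu Hv Hu' Hv' Hneg Hnz.
destruct (reparametrized_tangent g c phi s u u') as [x [Hx ->]]; try assumption.
{ intros ->. apply Hnz. unfold det2. simpl. ring. }
destruct (reparametrized_tangent g c psi t v v') as [y [Hy ->]]; try assumption.
{ intros ->. apply Hnz. unfold det2. simpl. ring. }
assert (Hdet : det2 (x * fst u', x * snd u') (y * fst v', y * snd v')
  = x * y * det2 u' v') by (unfold det2; simpl; ring).
rewrite Hdet in Hneg.
destruct (Rtotal_order (det2 u' v') 0) as [|[|Hpos]]; [assumption|contradiction|].
assert (0 <= x * y) by (apply Rmult_le_pos; assumption). nra.
Qed.

(** * Rotations and polar coordinates *)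

Lemma rotation_add (a b : R) (p : plane) :
  rotation a (rotation b p) = rotation (a + b) p.
Proof.
unfold rotation. simpl. rewrite cos_plus, sin_plus. f_equal; ring.
Qed.

Lemma rotation_zero (p : plane) : rotation 0 p = p.
Proof.
unfold rotation. rewrite cos_0, sin_0. destruct p. simpl. f_equal; ring.
Qed.

Lemma rotation_full_turn (p : plane) : rotation (2 * PI) p = p.
Proof.
unfold rotation. rewrite cos_2PI, sin_2PI. destruct p. simpl. f_equal; ring.
Qed.

Lemma rotation_inj (a : R) (p p' : plane) : rotation a p = rotation a p' -> p = p'.
Proof.
intro H. apply (f_equal (rotation (- a))) in H.
rewrite !rotation_add, Rplus_opp_l, !rotation_zero in H. exact H.
Qed.

Lemma rotation_polar (a r theta : R) :
  rotation a (polar r theta) = polar r (theta + a).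
Proof.
unfold rotation, polar. simpl. rewrite cos_plus, sin_plus. f_equal; ring.
Qed.

Lemma det2_rotation (a : R) (u v : plane) :
  det2 (rotation a u) (rotation a v) = det2 u v.
Proof.
unfold det2, rotation. simpl.
pose proof (sin2_cos2 a) as H. unfold Rsqr in H.
replace (fst u * snd v - snd u * fst v) with
  ((sin a * sin a + cos a * cos a) * (fst u * snd v - snd u * fst v))
  by (rewrite H; ring).
ring.
Qed.

Lemma is_tangent_rotation (a : R) (c : R -> plane) (t : R) (v : plane) :
  is_tangent c t v -> is_tangent (fun x => rotation a (c x)) t (rotation a v).
Proof.
intro H. split; simpl; [|apply is_tangent_linear, H].
replace (cos a * fst v - sin a * snd v)
  with (cos a * fst v + - sin a * snd v) by ring.
apply (is_derive_ext (fun x => cos a * fst (c x) + - sin a * snd (c x))).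
- intro x. simpl. ring.
- apply is_tangent_linear, H.
Qed.

Lemma polar_2PI (r theta : R) : polar r (theta + 2 * PI) = polar r theta.
Proof.
rewrite <- rotation_polar. apply rotation_full_turn.
Qed.

Lemma polar_inj (r r' theta theta' : R) :
  0 < r -> 0 < r' -> Rabs (theta - theta') < 2 * PI ->
  polar r theta = polar r' theta' -> r = r' /\ theta = theta'.
Proof.
intros Hr Hr' Hd H. unfold polar in H. injection H as H1 H2.
pose proof (sin2_cos2 theta) as Hs. pose proof (sin2_cos2 theta') as Hs'.
unfold Rsqr in Hs, Hs'.
assert (Hrr : r = r').
{ assert (r * r = r' * r'); [|nra].
  replace (r * r) with (r * sin theta * (r * sin theta)
    + r * cos theta * (r * cos theta)) by (rewrite <- (Rmult_1_r (r * r)), <- Hs; ring).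
  rewrite H1, H2. rewrite <- (Rmult_1_r (r' * r')), <- Hs'. ring. }
split; [exact Hrr|]. subst r'.
apply Rmult_eq_reg_l in H1; [|lra]. apply Rmult_eq_reg_l in H2; [|lra].
(* Halving brings the difference strictly between -π and π, where the sine vanishes only at 0. *)
set (d := (theta - theta') / 2).
assert (Hcos : cos (2 * d) = 1).
{ replace (2 * d) with (theta - theta') by (unfold d; lra).
  rewrite cos_minus, H1, H2. lra. }
rewrite cos_2a_sin in Hcos.
assert (Hsin : sin d = 0) by nra.
apply Rabs_def2 in Hd.
destruct (Rtotal_order d 0) as [Hlt|[Heq|Hgt]].
- assert (0 < sin (- d)) by (apply sin_gt_0; unfold d in *; lra).
  rewrite sin_neg in H. lra.
- unfold d in Heq. lra.
- assert (0 < sin d) by (apply sin_gt_0; unfold d in *; lra). lra.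
Qed.

Lemma polar_coordinates (p : plane) (theta0 : R) :
  p <> (0, 0) ->
  exists r theta, 0 < r /\ theta0 - PI < theta <= theta0 + PI /\ p = polar r theta.
Proof.
assert (H0 : forall p : plane, p <> (0, 0) ->
  exists r theta, 0 < r /\ - PI < theta <= PI /\ p = polar r theta).
{ clear p. intros [x y] Hp.
  assert (Hn : 0 < x * x + y * y).
  { destruct (Req_dec x 0) as [->|]; [|nra].
    destruct (Req_dec y 0) as [->|]; [|nra]. elim Hp. reflexivity. }
  set (r := sqrt (x * x + y * y)).
  assert (Hr : 0 < r) by (apply sqrt_lt_R0; exact Hn).
  assert (Hrr : r * r = x * x + y * y) by (apply sqrt_sqrt; lra).
  assert (Hx : -1 <= x / r <= 1).
  { split; [apply Rmult_le_reg_r with r|apply Rmult_le_reg_r with r]; try lra;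
      unfold Rdiv; rewrite Rmult_assoc, Rinv_l by lra; nra. }
  pose proof (acos_bound (x / r)) as Hb.
  assert (Hsin : r * sin (acos (x / r)) = Rabs y).
  { rewrite sin_acos by exact Hx. rewrite <- sqrt_Rsqr_abs.
    assert (Hrs : r = sqrt (r * r)) by (rewrite sqrt_square; lra).
    rewrite Hrs at 1. rewrite <- sqrt_mult_alt by nra. f_equal.
    unfold Rsqr. field_simplify; [|lra]. nra. }
  assert (Hcos : r * cos (acos (x / r)) = x).
  { rewrite cos_acos by exact Hx. field. lra. }
  destruct (Rle_lt_dec 0 y) as [Hy|Hy].
  - pose proof PI_RGT_0.
    exists r, (acos (x / r)). repeat split; try lra.
    unfold polar. rewrite Hcos, Hsin, Rabs_pos_eq by lra. reflexivity.
  (* Below the horizontal axis the angle is [- acos (x / r)]; the value -π must be excluded to stay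
     in the half-open range. *)
  - assert (acos (x / r) <> PI).
    { intro Heq. rewrite Heq, sin_PI, Rabs_left in Hsin; lra. }
    exists r, (- acos (x / r)). repeat split; try lra.
    unfold polar. rewrite cos_neg, sin_neg, Hcos.
    rewrite Ropp_mult_distr_r_reverse, Hsin, Rabs_left by lra.
    f_equal. lra. }
intros Hp. destruct (H0 (rotation (- theta0) p)) as (r & theta & Hr & Ht & Heq).
- intro H. apply Hp. apply (rotation_inj (- theta0)). rewrite H.
  unfold rotation. simpl. f_equal; ring.
- exists r, (theta + theta0). repeat split; try lra.
  rewrite <- rotation_polar, <- Heq, rotation_add, Rplus_opp_r, rotation_zero.
  reflexivity.
Qed.

(** * Angular sectors and their edges *)

Lemma polar_not_in_sector (theta0 theta1 r theta : R) :
  0 < r -> theta1 <= theta <= theta0 + 2 * PI ->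
  ~ in_open_sector theta0 theta1 (polar r theta).
Proof.
intros Hr Ht (r' & theta' & Hr' & Ht' & Heq).
apply polar_inj in Heq; try lra. apply Rabs_def1; lra.
Qed.

Lemma on_ray_not_in_sector (theta0 theta1 : R) (p : plane) :
  theta0 < theta1 <= theta0 + 2 * PI -> on_ray theta0 p \/ on_ray theta1 p ->
  ~ in_open_sector theta0 theta1 p.
Proof.
intros Ht [[r [Hr ->]]|[r [Hr ->]]].
- rewrite <- polar_2PI. apply polar_not_in_sector; lra.
- apply polar_not_in_sector; lra.
Qed.

Lemma det2_polar (r r' theta theta' : R) :
  det2 (polar r theta) (polar r' theta') = r * r' * sin (theta' - theta).
Proof. unfold det2, polar. simpl. rewrite sin_minus. ring. Qed.

Lemma sin_nonpos (x : R) : - PI <= x <= 0 -> sin x <= 0.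
Proof.
intro Hx. assert (0 <= sin (- x)) by (apply sin_ge_0; lra).
rewrite sin_neg in H. lra.
Qed.

(** The smaller of the signed distances to the lines carrying the two edges. It is positive exactly
    on an intersection of two half planes, which is the open sector when the angle is at most π. *)
Definition sector_fun (theta0 theta1 : R) (p : plane) : R :=
  Rmin (det2 (polar 1 theta0) p) (det2 p (polar 1 theta1)).

Lemma sector_fun_polar (theta0 theta1 r theta : R) :
  0 < r -> sector_fun theta0 theta1 (polar r theta)
  = r * Rmin (sin (theta - theta0)) (sin (theta1 - theta)).
Proof.
intro Hr. unfold sector_fun. rewrite !det2_polar, Rmult_1_r, Rmult_1_l.
unfold Rmin.
destruct (Rle_dec (r * sin (theta - theta0)) (r * sin (theta1 - theta)));
destruct (Rle_dec (sin (theta - theta0)) (sin (theta1 - theta))); nra.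
Qed.

Lemma sector_fun_pos (theta0 theta1 : R) (p : plane) :
  theta0 < theta1 <= theta0 + PI -> p <> (0, 0) ->
  (0 < sector_fun theta0 theta1 p <-> in_open_sector theta0 theta1 p).
Proof.
intros Ht Hp. split.
- destruct (polar_coordinates p theta0 Hp) as (r & theta & Hr & Hth & ->).
  rewrite sector_fun_polar by exact Hr. intro Hpos.
  assert (Hmin : 0 < Rmin (sin (theta - theta0)) (sin (theta1 - theta))) by nra.
  pose proof (Rmin_l (sin (theta - theta0)) (sin (theta1 - theta))).
  pose proof (Rmin_r (sin (theta - theta0)) (sin (theta1 - theta))).
  exists r, theta. split; [exact Hr|]. split; [|reflexivity]. split.
  + apply Rnot_le_lt. intro Hle.
    pose proof (sin_nonpos (theta - theta0)). lra.
  + apply Rnot_le_lt. intro Hle.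
    pose proof (sin_nonpos (theta1 - theta)). lra.
- intros (r & theta & Hr & Hth & ->). rewrite sector_fun_polar by exact Hr.
  apply Rmult_lt_0_compat; [exact Hr|].
  apply Rmin_glb_lt; apply sin_gt_0; lra.
Qed.

(** On the continuation of an edge beyond the origin the other distance is negative, except for the
    angle π, where that continuation is the other edge. *)
Lemma sector_fun_eq0 (theta0 theta1 : R) (p : plane) :
  theta0 < theta1 <= theta0 + PI -> p <> (0, 0) ->
  sector_fun theta0 theta1 p = 0 -> on_ray theta0 p \/ on_ray theta1 p.
Proof.
intros Ht Hp.
destruct (polar_coordinates p theta0 Hp) as (r & theta & Hr & Hth & ->).
rewrite sector_fun_polar by exact Hr. intro Hz.
assert (Hmin : Rmin (sin (theta - theta0)) (sin (theta1 - theta)) = 0) by nra.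
pose proof (Rmin_l (sin (theta - theta0)) (sin (theta1 - theta))).
pose proof (Rmin_r (sin (theta - theta0)) (sin (theta1 - theta))).
destruct (Req_dec theta theta0) as [->|N0].
{ left. exists r. split; [exact Hr|reflexivity]. }
destruct (Req_dec theta theta1) as [->|N1].
{ right. exists r. split; [exact Hr|reflexivity]. }
exfalso.
assert (Hlo : theta0 < theta).
{ apply Rnot_le_lt. intro Hle.
  assert (Hs : 0 < sin (- (theta - theta0))) by (apply sin_gt_0; lra).
  rewrite sin_neg in Hs. lra. }
assert (Hhi : theta < theta1).
{ apply Rnot_le_lt. intro Hle.
  assert (Hs : 0 < sin (- (theta1 - theta))) by (apply sin_gt_0; lra).
  rewrite sin_neg in Hs. lra. }
assert (Hpos : 0 < Rmin (sin (theta - theta0)) (sin (theta1 - theta))).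
{ apply Rmin_glb_lt; apply sin_gt_0; lra. }
lra.
Qed.

(** * Rotation invariance of the numbering *)

Lemma continuous_Rmin (f g : R -> R) (x : R) :
  continuous f x -> continuous g x -> continuous (fun t => Rmin (f t) (g t)) x.
Proof.
intros Hf Hg. apply continuity_pt_filterlim, continuity_pt_locally.
intros [e He].
destruct (continuous_eps f x e Hf He) as [d1 [Hd1 H1]].
destruct (continuous_eps g x e Hg He) as [d2 [Hd2 H2]].
assert (Hd : 0 < Rmin d1 d2) by (apply Rmin_glb_lt; assumption).
exists (mkposreal _ Hd). intros u Hu. simpl in *.
change (Rabs (u - x) < Rmin d1 d2) in Hu.
pose proof (Rmin_l d1 d2). pose proof (Rmin_r d1 d2).
specialize (H1 u ltac:(lra)). specialize (H2 u ltac:(lra)).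
apply Rabs_def2 in H1. apply Rabs_def2 in H2.
unfold Rmin. destruct (Rle_dec (f u) (g u)), (Rle_dec (f x) (g x));
  apply Rabs_def1; lra.
Qed.

Lemma continuous_det2 (c : R -> plane) (p : plane) (t : R) :
  continuous (fun x => fst (c x)) t -> continuous (fun x => snd (c x)) t ->
  continuous (fun x => det2 p (c x)) t.
Proof.
intros H1 H2. unfold det2.
apply (continuous_minus (V := R_NormedModule)
  (fun x => fst p * snd (c x)) (fun x => snd p * fst (c x)));
  apply (continuous_mult (K := R_AbsRing)); try assumption;
  apply continuous_const.
Qed.

Lemma sector_fun_continuous (D : diagram) (theta0 theta1 t : R) :
  virtual_knot_diagram D ->
  continuous (fun x => sector_fun theta0 theta1 (curve D x)) t.
Proof.
intro hD. destruct (curve_continuous D hD t) as [H1 H2].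
apply continuous_Rmin.
- apply continuous_det2; assumption.
- apply (continuous_ext (fun x => - det2 (polar 1 theta1) (curve D x))).
  + intro x. rewrite det2_sym. apply Ropp_involutive.
  + apply (continuous_opp (V := R_NormedModule)).
    apply continuous_det2; assumption.
Qed.

(** Integer translates of [y] on both sides of [t] force the sector function to vanish there, and
    the zeros nearest to [t] are the ends of the arc. The parameter [y] rules out a curve staying
    inside the sector forever. *)
Lemma sector_arc_exists (D : diagram) (theta0 theta1 t y : R) :
  virtual_knot_diagram D -> (forall x, curve D x <> (0, 0)) ->
  theta0 < theta1 <= theta0 + PI ->
  in_open_sector theta0 theta1 (curve D t) ->
  ~ in_open_sector theta0 theta1 (curve D y) ->
  exists a b, a < t < b /\ sector_arc D theta0 theta1 a b.
Proof.
intros hD Hnz Hth Ht Hy.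
set (f := fun x => sector_fun theta0 theta1 (curve D x)).
assert (Hc : forall x, continuous f x)
  by (intro x; apply sector_fun_continuous, hD).
assert (Hpos : forall x, 0 < f x <-> in_open_sector theta0 theta1 (curve D x)).
{ intro x. apply sector_fun_pos; [exact Hth|apply Hnz]. }
assert (Hout : forall k : Z, f (y + IZR k) <= 0).
{ intro k. apply Rnot_lt_le. intro H. apply Hy, Hpos.
  unfold f in H. rewrite (curve_eqmod1 D hD y) in H; [exact H|apply eqmod1_shift]. }
assert (Hray : forall x, f x = 0 ->
  on_ray theta0 (curve D x) \/ on_ray theta1 (curve D x)).
{ intros x Hx. apply sector_fun_eq0; [exact Hth|apply Hnz|exact Hx]. }
destruct (fundamental_domain t y) as [k Hk].
destruct (first_zero_right f t (y + IZR k) Hc) as [b [Hb [Hfb Htb]]];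
  [lra|apply Hpos, Ht|apply Hout|].
destruct (first_zero_left f t (y + IZR (k - 1)) Hc) as [a [Ha [Hfa Hat]]];
  [rewrite minus_IZR; lra|apply Hpos, Ht|apply Hout|].
exists a, b. split; [lra|]. split; [lra|]. split; [apply Hray, Hfa|].
split; [apply Hray, Hfb|]. intros x Hx. apply Hpos.
destruct (Rle_lt_dec x t); [apply Hat|apply Htb]; lra.
Qed.

(** The ends of each arc lie on an edge, hence never in the interior of the other arc. *)
Lemma sector_arc_unique (D : diagram) (theta0 theta1 a b a' b' t : R) :
  theta0 < theta1 <= theta0 + 2 * PI ->
  sector_arc D theta0 theta1 a b -> sector_arc D theta0 theta1 a' b' ->
  a < t < b -> a' < t < b' -> a = a' /\ b = b'.
Proof.
intros Hth (_ & Ha & Hb & Hin) (_ & Ha' & Hb' & Hin') Ht Ht'.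
assert (Hno : forall x, on_ray theta0 (curve D x) \/ on_ray theta1 (curve D x) ->
  ~ a < x < b /\ ~ a' < x < b').
{ intros x Hx.
  assert (Hn := on_ray_not_in_sector theta0 theta1 (curve D x) Hth Hx).
  split; intro H; apply Hn; [apply Hin|apply Hin']; exact H. }
destruct (Hno a Ha), (Hno b Hb), (Hno a' Ha'), (Hno b' Hb'). lra.
Qed.

Section Rotation_invariance.

Variables (K : diagram) (num : R -> Z) (theta : R) (h : R -> R).
Hypothesis hK : virtual_knot_diagram K.
Hypothesis hnum : alexander_numbering K num.
Hypothesis h_incr : increasing_cont h.
Hypothesis h_periodic : forall t, h (t + 1) = h t + 1.
Hypothesis h_curve : forall t, rotation theta (curve K t) = curve K (h t).
Hypothesis h_role : forall t, crossing_param K t -> role K t = role K (h t).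

Lemma lift_shift (t : R) (k : Z) : h (t + IZR k) = h t + IZR k.
Proof.
assert (H : h (t + IZR k) - (t + IZR k) = h t - t); [|lra].
apply (periodic_shift (fun x => h x - x)). intro x. rewrite h_periodic. lra.
Qed.

Lemma lift_eqmod1 (s t : R) : eqmod1 s t <-> eqmod1 (h s) (h t).
Proof.
split; intros [k Hk]; exists k.
- rewrite Hk. apply lift_shift.
- rewrite <- lift_shift in Hk. apply (increasing_cont_inj h); assumption.
Qed.

Lemma lift_surj (y : R) : exists x, h x = y.
Proof.
destruct (fundamental_domain (y - 1) (h 0)) as [k Hk].
rewrite <- lift_shift in Hk.
destruct (continuous_surj h (0 + IZR k) (0 + IZR k + 1) y) as [x [_ Hx]].
- apply h_incr.
- lra.
- left. rewrite h_periodic. lra.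
- exists x. exact Hx.
Qed.

Lemma lift_crossing (s t : R) : crossing K s t <-> crossing K (h s) (h t).
Proof.
unfold crossing. rewrite <- lift_eqmod1, <- !h_curve.
split; intros [H1 H2]; split; try exact H2.
- rewrite H1. reflexivity.
- apply (rotation_inj theta). exact H1.
Qed.

Lemma lift_classical_crossing (s t : R) :
  classical_crossing K s t <-> classical_crossing K (h s) (h t).
Proof.
unfold classical_crossing.
assert (H : crossing K s t -> role K s = role K (h s) /\ role K t = role K (h t)).
{ intro Hc. split; apply h_role.
  - exists t. apply crossing_sym, Hc.
  - exists s. exact Hc. }
rewrite <- lift_crossing.
split; intros (Hc & H1 & H2); destruct (H Hc) as [E1 E2];
  rewrite E1, E2 in *; tauto.
Qed.

Lemma lift_classical_param (t : R) :
  classical_param K (h t) -> classical_param K t.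
Proof.
intros [y Hy]. destruct (lift_surj y) as [s <-]. exists s.
apply lift_classical_crossing, Hy.
Qed.

(** The jump along the strand at [s] is 1 or -1 according to the sign of [det2], which is kept both
    by the rotation and by the continuous change of parameter [h]. *)
Lemma lift_jump (s t : R) : classical_crossing K s t ->
  exists j : Z,
    (exists m, value_before num s m /\ value_after num s (m + j)) /\
    (exists m, value_before num (h s) m /\ value_after num (h s) (m + j)).
Proof.
intro Hst. assert (Hst' := proj1 (lift_classical_crossing s t) Hst).
destruct hnum as (_ & _ & Hjump).
destruct (crossings_transverse _ hK s t (proj1 Hst)) as (u & v & Hu & Hv & Huv).
destruct (crossings_transverse _ hK _ _ (proj1 Hst')) as (u' & v' & Hu' & Hv' & Huv').
assert (Hrot : forall x, exists eps, 0 < eps /\ forall y, Rabs (y - x) < eps ->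
  rotation theta (curve K y) = curve K (h y)).
{ intro x. exists 1. split; [lra|]. intros y _. apply h_curve. }
assert (Hrev : det2 v u = - det2 u v) by apply det2_sym.
assert (Hrev' : det2 v' u' = - det2 u' v') by apply det2_sym.
destruct (Rtotal_order (det2 u v) 0) as [Hneg|[Heq|Hpos]]; [|contradiction|].
- assert (Hneg' : det2 u' v' < 0).
  { apply (reparametrized_det2_lt0 (curve K) (fun x => rotation theta (curve K x))
      h h s t (rotation theta u) (rotation theta v)); try assumption; try apply Hrot.
    - apply is_tangent_rotation, Hu.
    - apply is_tangent_rotation, Hv.
    - rewrite det2_rotation. exact Hneg. }
  destruct (Hjump s t u v Hst Hu Hv Hneg) as (m & Hm).
  destruct (Hjump _ _ u' v' Hst' Hu' Hv' Hneg') as (m' & Hm').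
  exists 1%Z. split; [exists m|exists m']; tauto.
- assert (Hneg' : det2 v' u' < 0).
  { apply (reparametrized_det2_lt0 (curve K) (fun x => rotation theta (curve K x))
      h h t s (rotation theta v) (rotation theta u)); try assumption; try apply Hrot.
    - apply is_tangent_rotation, Hv.
    - apply is_tangent_rotation, Hu.
    - rewrite det2_rotation. lra.
    - lra. }
  destruct (Hjump t s v u (classical_crossing_sym _ _ _ Hst) Hv Hu ltac:(lra))
    as (m & Hm).
  destruct (Hjump _ _ v' u' (classical_crossing_sym _ _ _ Hst') Hv' Hu' Hneg')
    as (m' & Hm').
  (* Here [s] is the strand running from right to left, with [m + 1] before the crossing and [m]
     after it. *)
  exists (-1)%Z. split; [exists (m + 1)%Z|exists (m' + 1)%Z];
    rewrite <- Z.add_assoc, Z.add_0_r; tauto.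
Qed.

Lemma lift_shifts_numbering : exists k : Z, forall t,
  ~ classical_param K t -> num (h t) = (num t + k)%Z.
Proof.
assert (Hreg : forall t, ~ classical_param K t ->
  exists eps, 0 < eps /\ forall u, Rabs (u - t) < eps ->
    num u = num t /\ num (h u) = num (h t)).
{ intros t Ht.
  destruct (numbering_locally_constant K hK num t hnum Ht) as [e1 [He1 H1]].
  destruct (numbering_locally_constant K hK num (h t) hnum) as [e2 [He2 H2]].
  { intro Hc. apply Ht, lift_classical_param, Hc. }
  destruct (continuous_eps h t e2 (proj2 h_incr t) He2) as [d [Hd Hh]].
  exists (Rmin e1 d). split; [apply Rmin_glb_lt; assumption|].
  pose proof (Rmin_l e1 d). pose proof (Rmin_r e1 d).
  intros u Hu. split; [apply H1; lra|apply H2, Hh; lra]. }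
destruct (punctured_locally_constant (fun t => (num (h t) - num t)%Z)) as [k Hk].
{ intro t. destruct (classic (classical_param K t)) as [[s Hs]|Ht].
  - apply classical_crossing_sym in Hs.
    destruct (lift_jump t s Hs) as (j & (m & Hb & Ha) & (m' & Hb' & Ha')).
    apply (value_before_comp num h t) in Hb'; [|exact h_incr].
    apply (value_after_comp num h t) in Ha'; [|exact h_incr].
    destruct Hb as [e1 [He1 H1]], Ha as [e2 [He2 H2]],
      Hb' as [e3 [He3 H3]], Ha' as [e4 [He4 H4]].
    exists (m' - m)%Z, (Rmin (Rmin e1 e2) (Rmin e3 e4)).
    split; [repeat apply Rmin_glb_lt; assumption|].
    pose proof (Rmin_l (Rmin e1 e2) (Rmin e3 e4)).
    pose proof (Rmin_r (Rmin e1 e2) (Rmin e3 e4)).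
    pose proof (Rmin_l e1 e2). pose proof (Rmin_r e1 e2).
    pose proof (Rmin_l e3 e4). pose proof (Rmin_r e3 e4).
    intros u [Hu0 Hu]. apply Rabs_def2 in Hu.
    destruct (Rtotal_order u t) as [Hlt|[->|Hgt]].
    + rewrite (H1 u), H3 by lra. reflexivity.
    + rewrite Rminus_diag, Rabs_R0 in Hu0. lra.
    + rewrite (H2 u), H4 by lra. ring.
  - destruct (Hreg t Ht) as [e [He H]]. exists (num (h t) - num t)%Z, e.
    split; [exact He|]. intros u [_ Hu]. destruct (H u Hu) as [-> ->].
    reflexivity. }
(* The value [k] is known only on punctured neighbourhoods; at a regular [t] local constancy carries
   it to the centre. *)
exists k. intros t Ht. destruct (Hreg t Ht) as [e [He H]].
destruct (Hk t) as [e' [He' H']].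
assert (Hmin : 0 < Rmin e e') by (apply Rmin_glb_lt; assumption).
pose proof (Rmin_l e e'). pose proof (Rmin_r e e').
assert (Habs : Rabs (t + Rmin e e' / 2 - t) = Rmin e e' / 2)
  by (rewrite Rabs_pos_eq; lra).
destruct (H (t + Rmin e e' / 2)) as [E1 E2]; [lra|].
specialize (H' (t + Rmin e e' / 2) ltac:(lra)). simpl in H'. lia.
Qed.

Lemma iter_lift_curve (n : nat) (t : R) :
  curve K (Nat.iter n h t) = rotation (INR n * theta) (curve K t).
Proof.
induction n as [|n IH].
- change (INR 0) with 0. rewrite Rmult_0_l, rotation_zero. reflexivity.
- rewrite Nat.iter_succ, <- h_curve, IH, rotation_add, S_INR. f_equal. ring.
Qed.

(** Two numberings of [K] differ by a constant [k]; as [h] has finite order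
    up to integer translations, a multiple of [k] vanishes. *)
Lemma numbering_lift_invariant (q : nat) :
  (0 < q)%nat -> INR q * theta = 2 * PI ->
  forall t, ~ classical_param K t -> num (h t) = num t.
Proof.
intros Hq Hth. destruct lift_shifts_numbering as [k Hk].
assert (Hiter : forall n t, ~ classical_param K t ->
  num (Nat.iter n h t) = (num t + Z.of_nat n * k)%Z /\
  ~ classical_param K (Nat.iter n h t)).
{ intros n t Ht. induction n as [|n [IH1 IH2]].
  - split; [simpl; ring|exact Ht].
  - rewrite Nat.iter_succ. split.
    + rewrite Hk by exact IH2. rewrite IH1. lia.
    + intro Hc. apply IH2, lift_classical_param, Hc. }
assert (Hz : k = 0%Z).
(* One non-crossing parameter, here [e / 2], is enough: there the full turn made by [q] iterations
   of [h] returns to the same point of the circle, so [q * k = 0]. *)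
{ destruct (crossings_isolated K hK 0) as [e [He Hfree]].
  specialize (Hfree (e / 2)). rewrite Rminus_0_r, Rabs_pos_eq in Hfree by lra.
  specialize (Hfree ltac:(lra)).
  assert (Hnc : ~ classical_param K (e / 2)).
  { intro Hc. apply Hfree, classical_param_crossing, Hc. }
  destruct (Hiter q (e / 2) Hnc) as [Hnum _].
  destruct (noncrossing_curve_inj K (Nat.iter q h (e / 2)) (e / 2) Hfree) as [j Hj].
  { rewrite iter_lift_curve, Hth. apply rotation_full_turn. }
  destruct hnum as (Hper & _ & _).
  assert (Heq : num (e / 2) = num (Nat.iter q h (e / 2))).
  { rewrite Hj at 1. apply periodic_shift, Hper. }
  assert (Z.of_nat q * k = 0)%Z by lia. nia. }
intros t Ht. rewrite Hk by exact Ht. lia.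
Qed.

End Rotation_invariance.

(** * The quotient diagram *)

Lemma sector_arc_shift (D : diagram) (theta0 theta1 a b : R) (k : Z) :
  virtual_knot_diagram D ->
  sector_arc D theta0 theta1 a b ->
  sector_arc D theta0 theta1 (a + IZR k) (b + IZR k).
Proof.
intros hD (Hab & Ha & Hb & Hin). split; [lra|].
rewrite (curve_eqmod1 D hD a (a + IZR k)), (curve_eqmod1 D hD b (b + IZR k))
  by apply eqmod1_shift.
split; [exact Ha|]. split; [exact Hb|]. intros t Ht.
rewrite (curve_eqmod1 D hD (t - IZR k) t).
- apply Hin. lra.
- exists k. lra.
Qed.

(** Both directions of travel get the same angular range, the complement of the open sector, by
    adding a full turn to the clockwise angle. *)
Lemma concentric_arc_angle (D : diagram) (theta0 theta1 a b : R) :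
  a < b -> theta0 < theta1 <= theta0 + PI ->
  concentric_arc D theta0 theta1 a b ->
  exists (r : R) (beta : R -> R),
    0 < r /\
    (forall t, a <= t <= b ->
       curve D t = polar r (beta t) /\ theta1 <= beta t <= theta0 + 2 * PI) /\
    (forall t t', beta t = beta t' -> t = t') /\
    (forall x, theta1 <= x <= theta0 + 2 * PI ->
       exists t, a <= t <= b /\ beta t = x) /\
    ((beta a = theta1 /\ beta b = theta0 + 2 * PI) \/
     (beta a = theta0 + 2 * PI /\ beta b = theta1)).
Proof.
intros Hab Hth (r & alpha & Hr & Hcurve & [(Hinc & Ha & Hb)|((Hdec & Hcont) & Ha & Hb)]).
- exists r, alpha. split; [exact Hr|]. split; [|split; [|split; [|tauto]]].
  + intros t Ht. split; [apply Hcurve, Ht|]. destruct Hinc as [Hi _].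
    destruct (Rle_lt_or_eq_dec a t) as [Hat| <-]; [lra| |lra].
    destruct (Rle_lt_or_eq_dec t b) as [Htb| ->]; [lra| |lra].
    apply Hi in Hat. apply Hi in Htb. lra.
  + intros t t'. apply increasing_cont_inj, Hinc.
  + intros x Hx. apply continuous_surj; [apply Hinc|lra|left; lra].
- assert (Hcont' : forall t, continuous (fun x => alpha x + 2 * PI) t).
  { intro t. apply (continuous_plus (V := R_NormedModule) alpha (fun _ => 2 * PI));
      [apply Hcont|apply continuous_const]. }
  exists r, (fun t => alpha t + 2 * PI).
  split; [exact Hr|]. split; [|split; [|split; [|right; lra]]].
  + intros t Ht. rewrite polar_2PI. split; [apply Hcurve, Ht|].
    destruct (Rle_lt_or_eq_dec a t) as [Hat| <-]; [lra| |lra].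
    destruct (Rle_lt_or_eq_dec t b) as [Htb| ->]; [lra| |lra].
    apply Hdec in Hat. apply Hdec in Htb. lra.
  + intros t t' Heq. destruct (Rtotal_order t t') as [Hlt|[|Hgt]]; [|assumption|].
    * apply Hdec in Hlt. lra.
    * apply Hdec in Hgt. lra.
  + intros x Hx.
    apply (continuous_surj (fun t => alpha t + 2 * PI)); [exact Hcont'|lra|right; lra].
Qed.

Lemma subdivision_right (c : nat -> R) (n : nat) (y : R) :
  c O <= y < c n -> exists i, (i < n)%nat /\ c i <= y < c (S i).
Proof.
induction n as [|n IH]; intro Hy; [lra|].
destruct (Rle_lt_dec (c n) y) as [Hle|Hlt].
- exists n. split; [lia|lra].
- destruct IH as [i [Hi Hy']]; [lra|]. exists i. split; [lia|exact Hy'].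
Qed.

Lemma subdivision_left (c : nat -> R) (n : nat) (y : R) :
  c O < y <= c n -> exists i, (i < n)%nat /\ c i < y <= c (S i).
Proof.
induction n as [|n IH]; intro Hy; [lra|].
destruct (Rlt_le_dec (c n) y) as [Hlt|Hle].
- exists n. split; [lia|lra].
- destruct IH as [i [Hi Hy']]; [lra|]. exists i. split; [lia|exact Hy'].
Qed.

Section Quotient.

Variables (K Ks : diagram) (num : R -> Z) (h : R -> R) (theta0 theta1 : R).
Variables (n : nat) (c d : nat -> R) (phi : nat -> R -> R).
Hypothesis hK : virtual_knot_diagram K.
Hypothesis hKs : virtual_knot_diagram Ks.
Hypothesis K_nonzero : forall t, curve K t <> (0, 0).
Hypothesis hnum : alexander_numbering K num.
Hypothesis hnum_lift : forall t, ~ classical_param K t -> num (h t) = num t.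
Hypothesis h_curve : forall t,
  rotation (theta1 - theta0) (curve K t) = curve K (h t).
Hypothesis htheta : theta0 < theta1 <= theta0 + PI.
Hypothesis transverse0 : transverse_to_ray K theta0.
Hypothesis transverse1 : transverse_to_ray K theta1.
Hypothesis c_closed : c n = c O + 1.
Hypothesis pieces : forall i, (i < n)%nat ->
  c i < d i < c (S i) /\
  increasing_cont (phi i) /\
  sector_arc K theta0 theta1 (phi i (c i)) (phi i (d i)) /\
  (forall t, c i <= t <= d i ->
     curve Ks t = curve K (phi i t) /\
     (crossing_param K (phi i t) -> role Ks t = role K (phi i t))) /\
  concentric_arc Ks theta0 theta1 (d i) (c (S i)).
Hypothesis arcs_once : forall a b, sector_arc K theta0 theta1 a b ->
  exists! i, (i < n)%nat /\
    exists k : Z, a = phi i (c i) + IZR k /\ b = phi i (d i) + IZR k.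

Lemma ray_noncrossing (t : R) :
  on_ray theta0 (curve K t) \/ on_ray theta1 (curve K t) -> ~ crossing_param K t.
Proof. intros [H|H]; [apply (transverse0 t H)|apply (transverse1 t H)]. Qed.

Lemma arc_ends_noncrossing (i : nat) : (i < n)%nat ->
  ~ crossing_param K (phi i (c i)) /\ ~ crossing_param K (phi i (d i)).
Proof.
intro Hi. destruct (pieces i Hi) as (_ & _ & (_ & Ha & Hb & _) & _).
split; apply ray_noncrossing; assumption.
Qed.

Lemma cut_points_le (i j : nat) : (i <= j <= n)%nat -> c i <= c j.
Proof.
intros [Hij Hj]. induction Hij as [|j Hij IH]; [lra|].
destruct (pieces j) as [H _]; [lia|]. specialize (IH ltac:(lia)). lra.
Qed.

Lemma cut_points_bounds (i : nat) : (i < n)%nat ->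
  c O <= c i /\ c i < d i < c (S i) /\ c (S i) <= c O + 1.
Proof.
intro Hi. rewrite <- c_closed. split; [apply cut_points_le; lia|].
split; [apply pieces, Hi|apply cut_points_le; lia].
Qed.

Lemma piece_right (x : R) :
  exists i (k : Z), (i < n)%nat /\ c i <= x + IZR k < c (S i).
Proof.
destruct (fundamental_domain (c O) x) as [k Hk].
destruct (subdivision_right c n (x + IZR k)) as [i Hi]; [lra|].
exists i, k. exact Hi.
Qed.

(** With pieces closed on the right, every parameter is either strictly inside a sector arc or on a
    closed concentric arc, both ends included. *)
Lemma piece_left (x : R) :
  exists i (k : Z), (i < n)%nat /\ c i < x + IZR k <= c (S i).
Proof.
destruct (fundamental_domain (c O) x) as [k Hk].
destruct (Rle_lt_or_eq_dec (c O) (x + IZR k)) as [Hlt|Heq]; [lra| |].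
- destruct (subdivision_left c n (x + IZR k)) as [i Hi]; [lra|].
  exists i, k. exact Hi.
(* The base point [c 0] belongs to the last piece, one turn further. *)
- destruct (subdivision_left c n (x + IZR (k + 1))) as [i Hi];
    [rewrite plus_IZR; lra|].
  exists i, (k + 1)%Z. exact Hi.
Qed.

Lemma piece_right_unique (i j : nat) (x y : R) :
  (i < n)%nat -> (j < n)%nat -> eqmod1 x y ->
  c i <= x < c (S i) -> c j <= y < c (S j) -> i = j /\ x = y.
Proof.
intros Hi Hj Hxy Hx Hy.
pose proof (cut_points_bounds i Hi). pose proof (cut_points_bounds j Hj).
assert (Heq : x = y) by (apply eqmod1_close; [exact Hxy|apply Rabs_def1; lra]).
split; [|exact Heq]. subst y.
destruct (Nat.lt_trichotomy i j) as [Hlt|[|Hgt]]; [|assumption|].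
- assert (c (S i) <= c j) by (apply cut_points_le; lia). lra.
- assert (c (S j) <= c i) by (apply cut_points_le; lia). lra.
Qed.

Lemma piece_left_unique (i j : nat) (x y : R) :
  (i < n)%nat -> (j < n)%nat -> eqmod1 x y ->
  c i < x <= c (S i) -> c j < y <= c (S j) -> i = j.
Proof.
intros Hi Hj Hxy Hx Hy.
pose proof (cut_points_bounds i Hi). pose proof (cut_points_bounds j Hj).
assert (Heq : x = y) by (apply eqmod1_close; [exact Hxy|apply Rabs_def1; lra]).
subst y.
destruct (Nat.lt_trichotomy i j) as [Hlt|[|Hgt]]; [|assumption|].
- assert (c (S i) <= c j) by (apply cut_points_le; lia). lra.
- assert (c (S j) <= c i) by (apply cut_points_le; lia). lra.
Qed.

Lemma arc_interior_in_sector (i : nat) (t : R) :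
  (i < n)%nat -> c i < t < d i -> in_open_sector theta0 theta1 (curve K (phi i t)).
Proof.
intros Hi Ht. destruct (pieces i Hi) as (_ & [Hinc _] & (_ & _ & _ & Hin) & _).
apply Hin. split; apply Hinc; lra.
Qed.

(** Two concentric arcs sharing a point have the same radius, hence overlap in
    infinitely many crossings. *)
Lemma concentric_noncrossing (i : nat) (x : R) :
  (i < n)%nat -> d i <= x <= c (S i) -> ~ crossing_param Ks x.
Proof.
intros Hi Hx [y Hyx]. pose proof PI_RGT_0 as HPI.
destruct (piece_left y) as (j & k & Hj & Hy).
set (y' := y + IZR k) in *.
assert (Hcross : crossing Ks y' x).
{ apply (crossing_eqmod1 Ks hKs y x);
    [apply eqmod1_shift|apply eqmod1_refl|exact Hyx]. }
destruct (pieces i Hi) as (Hci & _ & _ & _ & Hconc).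
destruct (pieces j Hj) as (Hcj & _ & _ & Hcurve & Hconc').
destruct (concentric_arc_angle _ _ _ _ _ (proj2 Hci) htheta Hconc)
  as (r & beta & Hr & Hbeta & Hinj & _ & _).
destruct (Hbeta x Hx) as [Hpx Hbx].
destruct Hcross as [Heq Hneq].
(* A strand inside the sector cannot meet the concentric arc, whose angles stay in the complementary
   range. *)
destruct (Rlt_le_dec y' (d j)) as [Hyd|Hyd].
{ apply (polar_not_in_sector theta0 theta1 r (beta x) Hr Hbx).
  rewrite <- Hpx, <- Heq. rewrite (proj1 (Hcurve y' ltac:(lra))).
  apply arc_interior_in_sector; [exact Hj|lra]. }
destruct (concentric_arc_angle _ _ _ _ _ (proj2 Hcj) htheta Hconc')
  as (r' & beta' & Hr' & Hbeta' & _ & Hsurj & _).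
destruct (Nat.eq_dec i j) as [<-|Hij].
- destruct (Hbeta y' ltac:(lra)) as [Hpy Hby].
  rewrite Hpx, Hpy in Heq. apply polar_inj in Heq; try assumption.
  2: { apply Rabs_def1; lra. }
  apply Hneq. rewrite (Hinj _ _ (proj2 Heq)). apply eqmod1_refl.
- destruct (Hbeta' y' ltac:(lra)) as [Hpy Hby].
  rewrite Hpx, Hpy in Heq. apply polar_inj in Heq; try assumption.
  2: { apply Rabs_def1; lra. }
  destruct Heq as [-> _].
  (* Both arcs sweep the whole complementary range, so with equal radii every parameter of arc [i]
     has a partner on arc [j], even arbitrarily close to the midpoint. *)
  destruct (crossings_isolated Ks hKs ((d i + c (S i)) / 2)) as [e [He Hfree]].
  set (z := (d i + c (S i)) / 2 + Rmin (e / 2) ((c (S i) - d i) / 2)).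
  assert (Hz : (d i + c (S i)) / 2 < z /\ z < (d i + c (S i)) / 2 + e /\ z <= c (S i)).
  { unfold z, Rmin. destruct (Rle_dec (e / 2) ((c (S i) - d i) / 2)); lra. }
  apply (Hfree z).
  { rewrite Rabs_pos_eq; lra. }
  destruct (Hbeta z ltac:(lra)) as [Hpz Hbz].
  destruct (Hsurj (beta z) Hbz) as [w [Hw Hbw]].
  exists w. split.
  + rewrite (proj1 (Hbeta' w Hw)), Hbw. symmetry. exact Hpz.
  + intro Hwz. apply Hij. symmetry.
    apply (piece_left_unique j i w z Hj Hi Hwz); lra.
Qed.

(** * The numbering carried to the quotient, and comparison of crossings *)

Lemma rotated_params_same_number (s t : R) :
  ~ crossing_param K s -> ~ crossing_param K t ->
  rotation (theta1 - theta0) (curve K s) = curve K t -> num s = num t.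
Proof.
intros Hs Ht Hrot. rewrite h_curve in Hrot.
destruct (noncrossing_curve_inj K (h s) t Ht Hrot) as [k ->].
rewrite (periodic_shift num (proj1 hnum)). symmetry. apply hnum_lift.
intro Hc. apply Hs, classical_param_crossing, Hc.
Qed.

Lemma next_piece (i : nat) : (i < n)%nat ->
  exists j (e : Z), (j < n)%nat /\ c (S i) = c j + IZR e /\
    num (phi i (d i)) = num (phi j (c j)).
Proof.
intro Hi. pose proof PI_RGT_0 as HPI.
assert (Hnext : exists j (e : Z), (j < n)%nat /\ c (S i) = c j + IZR e).
{ destruct (Nat.eq_dec (S i) n) as [Heq|Hne].
  - exists O, 1%Z. split; [lia|]. rewrite Heq. exact c_closed.
  - exists (S i), 0%Z. split; [lia|lra]. }
destruct Hnext as (j & e & Hj & Hcj). exists j, e.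
split; [exact Hj|]. split; [exact Hcj|].
destruct (pieces i Hi) as (Hci & _ & _ & Hcurve & Hconc).
destruct (pieces j Hj) as (Hdj & _ & _ & Hcurve' & _).
destruct (concentric_arc_angle _ _ _ _ _ (proj2 Hci) htheta Hconc)
  as (r & beta & Hr & Hbeta & _ & _ & Hends).
assert (H1 : curve K (phi i (d i)) = polar r (beta (d i))).
{ rewrite <- (proj1 (Hcurve (d i) ltac:(lra))). apply Hbeta. lra. }
assert (H2 : curve K (phi j (c j)) = polar r (beta (c (S i)))).
{ rewrite <- (proj1 (Hcurve' (c j) ltac:(lra))).
  rewrite <- (curve_eqmod1 Ks hKs (c j) (c (S i))).
  - apply Hbeta. lra.
  - exists e. exact Hcj. }
destruct (arc_ends_noncrossing i Hi) as [_ Hni].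
destruct (arc_ends_noncrossing j Hj) as [Hnj _].
(* A counterclockwise arc starts on the edge [theta1], so the rotation sends its end to its start;
   for a clockwise arc it sends the start to the end. *)
destruct Hends as [[E1 E2]|[E1 E2]]; rewrite E1 in H1; rewrite E2 in H2;
  rewrite ?polar_2PI in H1; rewrite ?polar_2PI in H2.
- symmetry. apply rotated_params_same_number; try assumption.
  rewrite H1, H2, rotation_polar. f_equal. ring.
- apply rotated_params_same_number; try assumption.
  rewrite H1, H2, rotation_polar. f_equal. ring.
Qed.

(** [Rmin] freezes the parameter at [d i], so the last value of a sector arc is kept along the
    concentric arc that follows. The formula is wanted on closed pieces, to be usable on either side
    of a cut point. *)
Lemma quotient_numbering_exists : exists numS : R -> Z,
  forall x i (k : Z), (i < n)%nat -> c i <= x + IZR k <= c (S i) ->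
    numS x = num (phi i (Rmin (x + IZR k) (d i))).
Proof.
destruct (functional_choice (fun x m => exists i (k : Z),
  (i < n)%nat /\ c i <= x + IZR k < c (S i) /\
  m = num (phi i (Rmin (x + IZR k) (d i))))) as [f Hf].
{ intro x. destruct (piece_right x) as (i & k & Hi & Hx).
  exists (num (phi i (Rmin (x + IZR k) (d i)))), i, k. tauto. }
exists f.
assert (Hhalf : forall x i (k : Z), (i < n)%nat -> c i <= x + IZR k < c (S i) ->
  f x = num (phi i (Rmin (x + IZR k) (d i)))).
{ intros x i k Hi Hx. destruct (Hf x) as (j & l & Hj & Hx' & ->).
  destruct (piece_right_unique j i (x + IZR l) (x + IZR k) Hj Hi) as [-> ->];
    try assumption; [|reflexivity].
  apply (eqmod1_trans _ x); [apply eqmod1_sym|]; apply eqmod1_shift. }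
intros x i k Hi Hx.
destruct (Rle_lt_or_eq_dec (x + IZR k) (c (S i))) as [Hlt|Heq]; [lra| |].
- apply Hhalf; [exact Hi|lra].
- destruct (next_piece i Hi) as (j & e & Hj & Hcj & Hnumj).
  destruct (cut_points_bounds j Hj) as (_ & Hdj & _).
  destruct (cut_points_bounds i Hi) as (_ & Hdi & _).
  (* [numS] reads the cut point [c (S i)] as the start of piece [j], after removing the turn [e]
     made when the index wraps around. *)
  assert (Hxj : x + IZR (k - e) = c j) by (rewrite minus_IZR; lra).
  rewrite (Hhalf x j (k - e)%Z Hj) by lra.
  rewrite Hxj, Heq, (Rmin_left (c j)), (Rmin_right (c (S i))) by lra.
  symmetry. exact Hnumj.
Qed.

(** The other strand also passes through the sector, so the existence part of [arcs_once] supplies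
    the quotient parameter that follows it. *)
Lemma classical_param_quotient (i : nat) (x : R) :
  (i < n)%nat -> c i < x < d i ->
  classical_param K (phi i x) -> classical_param Ks x.
Proof.
intros Hi Hx [t' (Hcross & Hr1 & Hr2)]. pose proof PI_RGT_0 as HPI.
destruct (pieces i Hi) as (Hci & _ & _ & Hcurve & _).
destruct (Hcurve x ltac:(lra)) as [Hcx Hrx].
assert (Hin := arc_interior_in_sector i x Hi Hx).
rewrite <- (proj1 Hcross) in Hin.
destruct (sector_arc_exists K theta0 theta1 t' (h t') hK K_nonzero htheta Hin)
  as (a & b & Hab & Harc).
(* [h t'] is the parameter outside the sector: a turn by the angle of the sector, at most π, moves
   the open sector into the complementary range. *)
{ rewrite <- h_curve. destruct Hin as (r & theta & Hr & Hth & ->).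
  rewrite rotation_polar. apply polar_not_in_sector; lra. }
destruct (arcs_once a b Harc) as (j & (Hj & k & Ha & Hb) & _).
destruct (pieces j Hj) as (Hcj & Hinc & _ & Hcurve' & _).
destruct (continuous_surj (phi j) (c j) (d j) (t' - IZR k)) as [y [Hy Hphiy]].
{ apply Hinc. }
{ lra. }
{ left. lra. }
assert (Hy' : c j < y < d j).
{ split; apply (increasing_cont_lt_inv (phi j)); try assumption; lra. }
destruct (Hcurve' y Hy) as [Hcy Hry].
assert (Heqm : eqmod1 t' (phi j y)) by (exists (- k)%Z; rewrite opp_IZR; lra).
assert (Hcross' : crossing K (phi j y) (phi i x)).
{ apply (crossing_eqmod1 K hK t' (phi i x)); [exact Heqm|apply eqmod1_refl|exact Hcross]. }
exists y. split; [split|split].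
- rewrite Hcx, Hcy. apply Hcross'.
- intro Hyx. destruct (piece_right_unique j i y x Hj Hi Hyx) as [-> ->]; [lra|lra|].
  apply (proj2 Hcross'). apply eqmod1_refl.
- rewrite Hry; [rewrite (role_eqmod1 K hK t' _ Heqm); exact Hr1|].
  exists (phi i x). apply crossing_sym, Hcross'.
- rewrite Hrx; [exact Hr2|]. exists t'. exact Hcross.
Qed.

(** Distinct parameters of the quotient must stay distinct in [K]. Otherwise two sector arcs share
    an interior point and coincide up to an integer shift, and the uniqueness part of [arcs_once]
    gives the same piece and the same parameter. *)
Lemma crossing_from_quotient (i j : nat) (x y : R) :
  (i < n)%nat -> (j < n)%nat -> c i < x < d i -> c j < y < d j ->
  classical_crossing Ks x y -> classical_crossing K (phi i x) (phi j y).
Proof.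
intros Hi Hj Hx Hy ((Heq & Hneq) & Hr1 & Hr2). pose proof PI_RGT_0 as HPI.
destruct (pieces i Hi) as (Hci & Hinci & Harci & Hcurvei & _).
destruct (pieces j Hj) as (Hcj & Hincj & Harcj & Hcurvej & _).
destruct (Hcurvei x ltac:(lra)) as [Hcx Hrx].
destruct (Hcurvej y ltac:(lra)) as [Hcy Hry].
assert (Hcross : crossing K (phi i x) (phi j y)).
{ split; [rewrite <- Hcx, <- Hcy; exact Heq|].
  intros [k Hk]. apply Hneq.
  destruct (sector_arc_unique K theta0 theta1 (phi i (c i) + IZR k)
    (phi i (d i) + IZR k) (phi j (c j)) (phi j (d j)) (phi j y)) as [Ea Eb].
  - lra.
  - apply sector_arc_shift; assumption.
  - exact Harcj.
  - rewrite Hk. split; apply Rplus_lt_compat_r; apply Hinci; lra.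
  - split; apply Hincj; lra.
  - assert (Hij : i = j).
    { destruct (arcs_once _ _ Harcj) as (l & _ & Hl).
      rewrite <- (Hl i), <- (Hl j); [reflexivity| |].
      - split; [exact Hj|]. exists 0%Z. lra.
      - split; [exact Hi|]. exists k. lra. }
    subst j. assert (x = y).
    { apply (increasing_cont_inj (phi i)); [exact Hinci|]. lra. }
    subst y. apply eqmod1_refl. }
split; [exact Hcross|]. split.
- rewrite <- Hrx; [exact Hr1|]. exists (phi j y). apply crossing_sym, Hcross.
- rewrite <- Hry; [exact Hr2|]. exists (phi i x). exact Hcross.
Qed.

Lemma quotient_almost_classical : almost_classical Ks.
Proof.
destruct quotient_numbering_exists as [numS HnumS].
(* Local constancy within one closed piece; at a cut point the pieces on its two sides are
   combined. *)
assert (Hpiece : forall x i (k : Z), ~ classical_param Ks x -> (i < n)%nat ->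
  c i <= x + IZR k <= c (S i) ->
  exists e, 0 < e /\ forall u, Rabs (u - x) < e ->
    c i <= u + IZR k <= c (S i) -> numS u = numS x).
{ intros x i k Hx Hi Hxi.
  destruct (pieces i Hi) as (Hci & [_ Hcont] & _).
  set (psi := fun u => phi i (Rmin (u + IZR k) (d i))).
  assert (Hpsi : continuous psi x).
  { apply (continuous_comp (fun u => Rmin (u + IZR k) (d i)) (phi i));
      [|apply Hcont].
    apply continuous_Rmin; [|apply continuous_const].
    apply (continuous_plus (V := R_NormedModule) (fun u : R => u) (fun _ => IZR k));
      [apply continuous_id|apply continuous_const]. }
  destruct (numbering_locally_constant K hK num (psi x) hnum) as [e [He Hloc]].
  (* The ends of a sector arc lie on the transverse edges, away from crossings; at an interior point
     a classical crossing of [K] would give one of [Ks] at [x]. *)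
  { intro Hc. unfold psi in Hc.
    destruct (arc_ends_noncrossing i Hi) as [N1 N2].
    destruct (Rle_lt_dec (d i) (x + IZR k)) as [Hle|Hlt].
    - rewrite Rmin_right in Hc by exact Hle.
      apply N2, classical_param_crossing, Hc.
    - rewrite Rmin_left in Hc by lra.
      destruct (Req_dec (x + IZR k) (c i)) as [Heq|Hne].
      + rewrite Heq in Hc. apply N1, classical_param_crossing, Hc.
      + apply classical_param_quotient in Hc; [|exact Hi|lra].
        destruct Hc as [s Hs]. apply Hx. exists s.
        apply (classical_crossing_eqmod1 Ks hKs s (x + IZR k));
          [apply eqmod1_refl|apply eqmod1_sym, eqmod1_shift|exact Hs]. }
  destruct (continuous_eps psi x e Hpsi He) as [e' [He' Hclose]].
  exists e'. split; [exact He'|]. intros u Hu Hui.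
  rewrite (HnumS u i k Hi Hui), (HnumS x i k Hi Hxi). apply Hloc, Hclose, Hu. }
assert (Hstrand : forall s, classical_param Ks s ->
  exists i (k : Z), (i < n)%nat /\ c i < s + IZR k < d i).
{ intros s Hs. destruct (piece_left s) as (i & k & Hi & Hsi).
  exists i, k. split; [exact Hi|].
  destruct (Rlt_le_dec (s + IZR k) (d i)) as [Hlt|Hle]; [lra|exfalso].
  apply (concentric_noncrossing i (s + IZR k) Hi); [lra|].
  destruct Hs as [t [Hs _]]. exists t.
  apply (crossing_eqmod1 Ks hKs t s); [apply eqmod1_refl|apply eqmod1_shift|exact Hs]. }
assert (Hlift : forall s i (k : Z), (i < n)%nat -> c i < s + IZR k < d i ->
  (exists e, 0 < e /\ forall x, Rabs (x - s) < e ->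
     curve Ks x = curve K (phi i (x + IZR k))) /\
  (exists e, 0 < e /\ forall x, Rabs (x - s) < e ->
     numS x = num (phi i (x + IZR k)))).
{ intros s i k Hi Hs.
  destruct (pieces i Hi) as (Hci & _ & _ & Hcurve & _).
  assert (He : 0 < Rmin (s + IZR k - c i) (d i - (s + IZR k)))
    by (apply Rmin_glb_lt; lra).
  pose proof (Rmin_l (s + IZR k - c i) (d i - (s + IZR k))).
  pose proof (Rmin_r (s + IZR k - c i) (d i - (s + IZR k))).
  split; eexists; (split; [exact He|]); intros x Hx; apply Rabs_def2 in Hx.
  - rewrite <- (proj1 (Hcurve (x + IZR k) ltac:(lra))).
    symmetry. apply (curve_eqmod1 Ks hKs), eqmod1_shift.
  - rewrite (HnumS x i k Hi) by lra. rewrite Rmin_left by lra. reflexivity. }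
exists numS. split; [|split].
- intro t. destruct (piece_right t) as (i & k & Hi & Ht).
  (* Lowering the shift by one describes [t + 1] by the same point of the same piece. *)
  assert (E : t + 1 + IZR (k - 1) = t + IZR k) by (rewrite minus_IZR; lra).
  rewrite (HnumS (t + 1) i (k - 1)%Z Hi), (HnumS t i k Hi), E by lra.
  reflexivity.
- intros s t Hst Hfree. apply locally_constant_interval; [exact Hst|].
  intros x Hx. specialize (Hfree x Hx).
  (* Piece [i] contains a left neighbourhood of [x] and piece [j] a right one; the margins in the
     radius below keep [y] inside them. *)
  destruct (piece_left x) as (i & k & Hi & Hxi).
  destruct (piece_right x) as (j & l & Hj & Hxj).
  destruct (Hpiece x i k Hfree Hi ltac:(lra)) as [e1 [He1 H1]].
  destruct (Hpiece x j l Hfree Hj ltac:(lra)) as [e2 [He2 H2]].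
  exists (Rmin (Rmin e1 e2) (Rmin (x + IZR k - c i) (c (S j) - (x + IZR l)))).
  pose proof (Rmin_l (Rmin e1 e2) (Rmin (x + IZR k - c i) (c (S j) - (x + IZR l)))).
  pose proof (Rmin_r (Rmin e1 e2) (Rmin (x + IZR k - c i) (c (S j) - (x + IZR l)))).
  pose proof (Rmin_l e1 e2). pose proof (Rmin_r e1 e2).
  pose proof (Rmin_l (x + IZR k - c i) (c (S j) - (x + IZR l))).
  pose proof (Rmin_r (x + IZR k - c i) (c (S j) - (x + IZR l))).
  split; [repeat apply Rmin_glb_lt; lra|]. split; intros y Hy.
  + apply H1; [apply Rabs_def1; lra|lra].
  + apply H2; [apply Rabs_def1; lra|lra].
- intros s t u v Hst Hu Hv Huv.
  destruct (Hstrand s) as (i & k & Hi & Hs).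
  { exists t. apply classical_crossing_sym, Hst. }
  destruct (Hstrand t) as (j & l & Hj & Ht).
  { exists s. exact Hst. }
  destruct (Hlift s i k Hi Hs) as [Hcs Hns].
  destruct (Hlift t j l Hj Ht) as [Hct Hnt].
  assert (HstK : classical_crossing K (phi i (s + IZR k)) (phi j (t + IZR l))).
  { apply crossing_from_quotient; try assumption.
    apply (classical_crossing_eqmod1 Ks hKs s t);
      [apply eqmod1_shift|apply eqmod1_shift|exact Hst]. }
  destruct (crossings_transverse _ hK _ _ (proj1 HstK)) as (u' & v' & Hu' & Hv' & Hnz).
  destruct (pieces i Hi) as (_ & Hinci & _). destruct (pieces j Hj) as (_ & Hincj & _).
  apply (increasing_cont_shift _ (IZR k)) in Hinci.
  apply (increasing_cont_shift _ (IZR l)) in Hincj.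
  assert (Hneg : det2 u' v' < 0).
  { apply (reparametrized_det2_lt0 (curve K) (curve Ks)
      (fun x => phi i (x + IZR k)) (fun x => phi j (x + IZR l)) s t u v);
      assumption. }
  destruct hnum as (_ & _ & Hjump).
  destruct (Hjump _ _ u' v' HstK Hu' Hv' Hneg) as (lambda & B1 & A1 & B2 & A2).
  exists lambda. repeat split.
  + apply (value_before_ext _ numS s lambda Hns).
    apply (value_before_comp num (fun x => phi i (x + IZR k))); assumption.
  + apply (value_after_ext _ numS t lambda Hnt).
    apply (value_after_comp num (fun x => phi j (x + IZR l))); assumption.
  + apply (value_before_ext _ numS t (lambda + 1) Hnt).
    apply (value_before_comp num (fun x => phi j (x + IZR l))); assumption.
  + apply (value_after_ext _ numS s (lambda + 1) Hns).
    apply (value_after_comp num (fun x => phi i (x + IZR k))); assumption.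
Qed.

End Quotient.

Theorem corollary3p6 (q : nat) (K Kstar : diagram)
  (hq : (2 <= q)%nat)
  (hK : virtual_knot_diagram K)
  (hper : periodic q K)
  (hac : almost_classical K)
  (hquot : is_quotient q K Kstar) :
  almost_classical Kstar.
Proof.
destruct hper as [Hnz (h & Hinc & Hshift & Hcurve & Hrole)].
destruct hac as [num Hnum].
destruct hquot as (hKs & theta0 & theta1 & n & c & d & phi & Hth & Htr0 & Htr1
  & Hcn & Hpieces & Honce).
assert (Hq : 2 <= INR q) by (apply (le_INR 2), hq).
assert (Hmul : INR q * (2 * PI / INR q) = 2 * PI) by (field; lra).
pose proof PI_RGT_0 as HPI.
assert (Hpos : 0 < 2 * PI / INR q) by (apply Rdiv_lt_0_compat; lra).
assert (Hle : 2 * PI / INR q <= PI) by nra.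
(* Periodicity compares roles at the crossings of the rotated diagram; those of [K] occur at the
   same parameters. *)
assert (Hrole' : forall t, crossing_param K t -> role K t = role K (h t)).
{ intros t [s [Hst Hn]]. apply Hrole. exists s. split; [|exact Hn].
  simpl. rewrite Hst. reflexivity. }
apply (quotient_almost_classical K Kstar num h theta0 theta1 n c d phi);
  try assumption; try lra.
- apply (numbering_lift_invariant K num (2 * PI / INR q) h) with (q := q);
    try assumption. lia.
- intro t. replace (theta1 - theta0) with (2 * PI / INR q) by lra. apply Hcurve.
Qed.
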